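(* Let $S$ be a surface in the $3$-dimensional real projective space $\mathbb P^3$ with $bc\neq0$, given by a lift $f:\mathbb D\to\mathbb R^4\setminus\{\mathbf 0\}$ satisfying its canonical system, let $F$ be its Wilczynski frame (with values in $\mathrm{SL}_4\mathbb R$) and $g_1=FJ_1F^t:\mathbb D\to\mathcal Q$ its first-order Gauss map. Then the following are equivalent: (1) $S$ is a Demoulin surface. (2) The first-order Gauss map $g_1$ is a conformal Lorentz harmonic map into $\mathcal Q$.
   Context: Surfaces. $\mathbb D\subset\mathbb R^2$ is a simply connected domain with coordinates $(x,y)$; all functions are smooth. A surface $S$ in $\mathbb P^3$ is represented by a lift $f:\mathbb D\to\mathbb R^4\setminus\{\mathbf 0\}$ satisfying the canonical system $$f_{xx}=b f_y+p f,\qquad f_{yy}=c f_x+q f,$$ where $b,c,p,q$ are real functions of $(x,y)$ and $f,f_x,f_y,f_{xy}$ are linearly independent at each point. The coordinates $(x,y)$ are asymptotic coordinates of $S$, and the Lorentz conformal structure on $\mathbb D$ induced by $S$ is that for which $x,y$ are null coordinates (the conformal class of $dx\,dy$). It is assumed that $bc\ne0$ everywhere. Invariants. Put $$P = p + \frac{b_y}{2} -\frac{c_{xx}}{2 c} + \frac{c_x^2}{4 c^2},\qquad Q = q + \frac{c_x}{2} - \frac{b_{yy}}{2 b}+ \frac{b_y^2}{4 b^2}.$$ $S$ is a Demoulin surface if $P=Q=0$ identically. Wilczynski frame. $F=(f,f_1,f_2,\eta)$ (columns) with $$f_1=f_x-\frac{c_x}{2c}f,\quad f_2=f_y-\frac{b_y}{2b}f,\quad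 \eta=f_{xy}-\frac{c_x}{2c}f_y-\frac{b_y}{2b}f_x+\Big(\frac{b_yc_x}{4bc}-\frac{bc}{2}\Big)f.$$ The determinant of $F$ is constant, and it is assumed throughout that $F$ takes values in $\mathrm{SL}_4\mathbb R$. First-order Gauss map. $J_1$ is the $4\times4$ matrix with entries $1$ on the anti-diagonal and $0$ elsewhere. $\mathcal Q$ is the space of real symmetric $4\times 4$ matrices of determinant one and signature $(2,2)$, on which $\mathrm{SL}_4\mathbb R$ acts transitively by $g\cdot p=gpg^t$; $\mathcal Q\cong\mathrm{SL}_4\mathbb R/K_1$ with $K_1=\{X\in\mathrm{SL}_4\mathbb R: XJ_1X^t=J_1\}\cong\mathrm{SO}_{2,2}$. The first-order Gauss map is $g_1=FJ_1F^t:\mathbb D\to\mathcal Q$. $\mathcal Q$ carries the $\mathrm{SL}_4\mathbb R$-invariant pseudo-Riemannian metric $\langle X,Y\rangle_p=\mathrm{Tr}(p^{-1}Xp^{-1}Y)$ for $X,Y\in T_p\mathcal Q$. Conformality. $g_1$ is conformal if the pullback of this metric by $g_1$ is a (function) multiple of $dx\,dy$, i.e. $\langle (g_1)_x,(g_1)_x\rangle=\langle (g_1)_y,(g_1)_y\rangle=0$. Lorentz harmonicity. A map $\varphi:\mathbb D\to\mathcal Q$ is Lorentz harmonic if it is harmonic with respect to the Lorentz conformal structure $[dx\,dy]$ on $\mathbb D$ and this metric on $\mathcal Q$, i.e. $\nabla_{\partial_x}\varphi_y=0$, where $\nabla$ is the pullback of the Levi-Civita connection of $\mathcal Q$. *)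

(* Defs.v *)
From HB Require Import structures.
From mathcomp Require Import all_boot all_order all_algebra.
From mathcomp Require Import all_classical all_reals all_analysis.

Set Implicit Arguments.
Unset Strict Implicit.
Unset Printing Implicit Defensive.

Import Order.TTheory GRing.Theory Num.Theory.
Import numFieldNormedType.Exports.

Local Open Scope classical_set_scope.
Local Open Scope ring_scope.

Section Plane.
Context {R : realType}.

Definition dx {V : normedModType R} (h : R * R -> V) : R * R -> V :=
  fun z => 'D_((1, 0) : R * R) h z.

Definition dy {V : normedModType R} (h : R * R -> V) : R * R -> V :=
  fun z => 'D_((0, 1) : R * R) h z.

(* The word w lists the successive partial derivatives, the last letter being
   applied first; true stands for x and false for y. *)
Fixpoint partials {V : normedModType R} (w : seq bool) (h : R * R -> V) :
    R * R -> V :=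
  if w is i :: w' then (if i then dx else dy) (partials w' h) else h.

(* C^oo on D (meant for D open): all iterated partial derivatives are Frechet
   differentiable at every point of D. *)
Definition smooth_on {V : normedModType R} (D : set (R * R))
    (h : R * R -> V) : Prop :=
  forall (w : seq bool) (z : R * R), D z -> differentiable (partials w h) z.

(* Every loop in D contracts in D to its base point, which stays fixed. *)
Definition loops_contract (D : set (R * R)) : Prop :=
  forall gamma : R -> R * R,
    {within `[0, 1]%classic, continuous gamma} ->
    (forall t : R, t \in `[0, 1] -> D (gamma t)) ->
    gamma 0 = gamma 1 ->
    exists H : R * R -> R * R,
      [/\ {within `[0, 1]%classic `*` `[0, 1]%classic, continuous H},
          forall s t : R, s \in `[0, 1] -> t \in `[0, 1] -> D (H (s, t)),
          forall t : R, t \in `[0, 1] ->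
            H (0, t) = gamma t /\ H (1, t) = gamma 0 &
          forall s : R, s \in `[0, 1] ->
            H (s, 0) = gamma 0 /\ H (s, 1) = gamma 0].

Definition simply_connected_domain (D : set (R * R)) : Prop :=
  [/\ D !=set0, open D, connected D & loops_contract D].

End Plane.

Section Surface.
Context {R : realType}.
Implicit Types (D : set (R * R)) (b c p q : R * R -> R)
  (f : R * R -> 'cV[R]_4).

Definition cols4 (v0 v1 v2 v3 : 'cV[R]_4) : 'M[R]_4 :=
  \matrix_(i, j) ([:: v0; v1; v2; v3]`_j) i 0.

Record surface_lift D b c p q f : Prop := SurfaceLift {
  sl_smooth : [/\ smooth_on D b, smooth_on D c, smooth_on D p & smooth_on D q];
  sl_smooth_lift : smooth_on D f;
  sl_neq0 : forall z, D z -> f z != 0;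
  sl_xx : forall z, D z -> dx (dx f) z = b z *: dy f z + p z *: f z;
  sl_yy : forall z, D z -> dy (dy f) z = c z *: dx f z + q z *: f z;
  sl_free : forall z, D z -> free [:: f z; dx f z; dy f z; dy (dx f) z] }.

Definition invP b c p : R * R -> R := fun z =>
  p z + dy b z / 2 - dx (dx c) z / (2 * c z) + dx c z ^+ 2 / (4 * c z ^+ 2).

Definition invQ b c q : R * R -> R := fun z =>
  q z + dx c z / 2 - dy (dy b) z / (2 * b z) + dy b z ^+ 2 / (4 * b z ^+ 2).

Definition demoulin D b c p q : Prop :=
  forall z, D z -> invP b c p z = 0 /\ invQ b c q z = 0.

Definition wilczynski_frame b c f : R * R -> 'M[R]_4 := fun z =>
  let f1 := dx f z - (dx c z / (2 * c z)) *: f z in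
  let f2 := dy f z - (dy b z / (2 * b z)) *: f z in
  let eta := dy (dx f) z - (dx c z / (2 * c z)) *: dy f z
             - (dy b z / (2 * b z)) *: dx f z
             + (dy b z * dx c z / (4 * b z * c z) - b z * c z / 2) *: f z in
  cols4 (f z) f1 f2 eta.

Definition J1 : 'M[R]_4 := \matrix_(i, j) (i + j == 3)%N%:R.

Definition gauss_map1 b c f : R * R -> 'M[R]_4 := fun z =>
  wilczynski_frame b c f z *m J1 *m (wilczynski_frame b c f z)^T.

End Surface.

Section SymmetricSpace.
Context {R : realType}.
Implicit Types s : 'M[R]_4.

Definition signature22 s : Prop :=
  exists2 g : 'M[R]_4, g \in unitmx &
    s = g *m (block_mx 1%:M 0 0 (- 1%:M) : 'M[R]_(2 + 2)) *m g^T.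

Definition calQ : set 'M[R]_4 :=
  [set s | [/\ s^T = s, \det s = 1 & signature22 s]].

(* The signature is locally constant on invertible symmetric matrices, so calQ
   is open in the hypersurface det = 1 of the space of symmetric matrices, and
   T_s calQ is the kernel of the differential of det in that space. *)
Definition tangent s (X : 'M[R]_4) : Prop :=
  X^T = X /\ 'D_X (fun s' : 'M[R]_4 => \det s') s = 0.

Definition metric s (X Y : 'M[R]_4) : R := \tr (invmx s *m X *m invmx s *m Y).

(* Tangent vector fields of calQ, given by maps on the ambient matrix space;
   only their values on calQ are used: derivatives are taken in directions
   tangent to calQ. *)
Definition vector_field (Y : 'M[R]_4 -> 'M[R]_4) : Prop :=
  forall s, calQ s -> differentiable Y s /\ tangent s (Y s).

(* As calQ is a submanifold of a vector space, each connection on it differs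
   from the flat derivative by a tensor Gamma s : T_s x T_s -> 'M_4:
   (nabla_X Y) s = 'D_X Y s - Gamma s X (Y s). *)
Definition covd (Gamma : 'M[R]_4 -> 'M[R]_4 -> 'M[R]_4 -> 'M[R]_4)
    (X : 'M[R]_4) (Y : 'M[R]_4 -> 'M[R]_4) (s : 'M[R]_4) : 'M[R]_4 :=
  'D_X Y s - Gamma s X (Y s).

Record connection (Gamma : 'M[R]_4 -> 'M[R]_4 -> 'M[R]_4 -> 'M[R]_4) : Prop :=
  Connection {
  conn_linear_l : forall s (a : R) X X' Y, calQ s ->
    tangent s X -> tangent s X' -> tangent s Y ->
    Gamma s (a *: X + X') Y = a *: Gamma s X Y + Gamma s X' Y;
  conn_linear_r : forall s (a : R) X Y Y', calQ s ->
    tangent s X -> tangent s Y -> tangent s Y' ->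
    Gamma s X (a *: Y + Y') = a *: Gamma s X Y + Gamma s X Y';
  conn_tangent : forall s X Y, calQ s -> tangent s X -> vector_field Y ->
    tangent s (covd Gamma X Y s) }.

Definition torsion_free Gamma : Prop :=
  forall X Y s, vector_field X -> vector_field Y -> calQ s ->
    covd Gamma (X s) Y s - covd Gamma (Y s) X s = 'D_(X s) Y s - 'D_(Y s) X s.

Definition metric_compatible Gamma : Prop :=
  forall X Y Z s, calQ s -> tangent s X -> vector_field Y -> vector_field Z ->
    'D_X (fun s' => metric s' (Y s') (Z s')) s =
      metric s (covd Gamma X Y s) (Z s) + metric s (Y s) (covd Gamma X Z s).

(* By the uniqueness of the Levi-Civita connection this determines Gamma s on
   T_s x T_s; the smoothness of Gamma in s then need not be required. *)
Definition levi_civita Gamma : Prop :=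
  [/\ connection Gamma, torsion_free Gamma & metric_compatible Gamma].

(* nabla_{d/dx} V for the pullback by phi of the connection given by Gamma,
   where V is a vector field along phi. *)
Definition pullback_dx (Gamma : 'M[R]_4 -> 'M[R]_4 -> 'M[R]_4 -> 'M[R]_4)
    (phi V : R * R -> 'M[R]_4) : R * R -> 'M[R]_4 :=
  fun z => dx V z - Gamma (phi z) (dx phi z) (V z).

Definition maps_into_calQ (D : set (R * R)) (phi : R * R -> 'M[R]_4) : Prop :=
  forall z, D z -> calQ (phi z).

(* The quadratic form dx dy takes the value v.1 * v.2 on the vector v. *)
Definition conformal (D : set (R * R)) (phi : R * R -> 'M[R]_4) : Prop :=
  exists lambda : R * R -> R, forall z (v : R * R), D z ->
    metric (phi z) ('D_v phi z) ('D_v phi z) = lambda z * (v.1 * v.2).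

Definition lorentz_harmonic (D : set (R * R)) (phi : R * R -> 'M[R]_4) : Prop :=
  exists2 Gamma, levi_civita Gamma &
    forall z, D z -> pullback_dx Gamma phi (dy phi) z = 0.

End SymmetricSpace.

(* Main.v *)
Require Import Defs.
From HB Require Import structures.
From mathcomp Require Import all_boot all_order all_algebra.
From mathcomp Require Import all_classical all_reals all_analysis.
From mathcomp Require Import perm ring lra.

Set Implicit Arguments.
Unset Strict Implicit.
Unset Printing Implicit Defensive.

Import Order.TTheory GRing.Theory Num.Theory.
Import numFieldNormedType.Exports.

Local Open Scope classical_set_scope.
Local Open Scope ring_scope.

(* With a = c_x/2c, e = b_y/2b, k = bc/2 - e_x and l = bc/2 - a_y the Wilczynski
   frame satisfies F_x = F U and F_y = F V for explicit matrices U, V.  Hence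
   (g_1)_x = F A J_1 F^t and (g_1)_y = F B J_1 F^t, where A and B are twice the
   parts of U and V symmetric about the anti-diagonal, and
   <(g_1)_x, (g_1)_x> = Tr A^2 = 16 P, <(g_1)_y, (g_1)_y> = Tr B^2 = 16 Q:
   conformality alone is equivalent to P = Q = 0.
   The Levi-Civita connection is D_X Y - (X s^-1 Y + Y s^-1 X) / 2, so that
   harmonicity reads B_x + U B - B U + B A = (A B + B A) / 2.  When P = Q = 0
   this reduces to c_x = 2ac, which is the definition of a, and l_x = -2al, which
   is the compatibility condition (f_1)_xy = (f_1)_yx. *)

(** The equations F_x = F U and F_y = F V are more than a rewriting of the canonical system:
    differentiating the last column of F brings in p_y and q_x. These are eliminated by
    compatibility: the two orders of differentiating f_xy once in x and once in y give a relation
    between f, f_x and f_y, whose coefficients vanish because f, f_x, f_y, f_xy are independent. The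
    anti-diagonal enters because U -> J_1 U^t J_1 is the reflection in it, so that A = U + J_1 U^t
    J_1 and B = V + J_1 V^t J_1. Harmonicity asks for some tensor satisfying the axioms of the
    Levi-Civita connection, so the explicit formula is checked against them. The delicate axiom is
    tangency of the covariant derivative: a vector field is tangent only at points of Q, and the
    conditions defining tangency have to be differentiated along curves that stay in Q, not along
    straight lines. *)

(** * Symmetry of mixed partial derivatives *)

Lemma is_derive_lineP (R : realType) (V W : normedModType R) (h : V -> W)
    (w u : V) (s : R) (dh : W) :
  is_derive s 1 (fun s : R => h (w + s *: u)) dh <->
  is_derive (w + s *: u) u h dh.
Proof.
have E :
    (fun k : R => k^-1 *: (((fun s : R => h (w + s *: u)) \o shift s) (k *: 1)
                           - h (w + s *: u)))
  = (fun k : R => k^-1 *: ((h \o shift (w + s *: u)) (k *: u)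
                           - h (w + s *: u))).
  apply/funext => k /=.
  by rewrite [k *: 1]mulr1 scalerDl addrCA.
have Ed : 'D_1 (fun s : R => h (w + s *: u)) s = 'D_u h (w + s *: u).
  by rewrite /derive E.
have El : derivable (fun s : R => h (w + s *: u)) s 1
        = derivable h (w + s *: u) u.
  by rewrite /derivable E.
by split=> -[hd <-]; split; rewrite ?Ed// ?El// -?El.
Qed.

(* The second difference h(z+tu+tv) - h(z+tu) - h(z+tv) + h(z) is symmetric in
   u and v, and only the differentiability of 'D_u h at z is used to compare it
   with t^2 'D_v ('D_u h) z. *)
Lemma second_difference (R : realType) (V : normedModType R) (h : V -> R)
    (z u v : V) :
  {near z, forall w, differentiable h w} ->
  differentiable (fun w => 'D_u h w) z ->
  forall eps : R, 0 < eps -> \forall t \near 0^'+,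
    `|h (z + t *: u + t *: v) - h (z + t *: u) - h (z + t *: v) + h z
      - t ^+ 2 * 'D_v (fun w => 'D_u h w) z| <= eps * t ^+ 2.
Proof.
move=> hd ud eps eps0.
set L := 'd (fun w => 'D_u h w) z.
have C0 : 0 < 2 * `|u| + `|v| + 1.
  by have := normr_ge0 u; have := normr_ge0 v; lra.
(* The two linearisation errors are at most e |s u| and e |s u + t v|, with sum at most e t (2 |u| +
   |v|); the 1 keeps the denominator positive when u = v = 0. *)
set e := eps / (2 * `|u| + `|v| + 1).
have e0 : 0 < e by rewrite divr_gt0.
have est : \forall w \near (0 : V),
    `|'D_u h (z + w) - 'D_u h z - L w| <= e * `|w|.
  have /eqaddoP/(_ _ e0) := diff_locally ud.
  apply: filterS => w /=; rewrite !fctE /= /shift /= opprD addrA [w + z]addrC;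
    exact.
have [r /= r0 Hr] : exists2 r : R, 0 < r & forall w, `|w| < r ->
   differentiable h (z + w) /\ `|'D_u h (z + w) - 'D_u h z - L w| <= e * `|w|.
  have hd0 : \forall w \near (0 : V), differentiable h (z + w).
    move: hd; rewrite (near_shift 0 z) /=.
    by apply: filterS => x /=; rewrite subr0 addrC.
  have /nbhs_normP[r r0 Hr] : \forall w \near (0 : V),
    differentiable h (z + w) /\ `|'D_u h (z + w) - 'D_u h z - L w| <= e * `|w|.
    exact: filterI hd0 est.
  by exists r => // w wr; apply: Hr; rewrite /= sub0r normrN.
near=> t.
have t0 : 0 < t by near: t; exact: nbhs_right_gt.
have tr : t * (2 * `|u| + `|v| + 1) < r.
  rewrite -ltr_pdivlMr//; near: t; apply: nbhs_right_lt; exact: divr_gt0.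
have small s : 0 <= s <= t -> `|s *: u| < r /\ `|s *: u + t *: v| < r.
  move=> /andP[s0 st].
  have A : `|s *: u| <= t * `|u|.
    by rewrite normrZ ger0_norm// ler_wpM2r.
  have B : `|t *: v| = t * `|v| by rewrite normrZ gtr0_norm.
  have Cu : 0 <= t * `|u| by rewrite mulr_ge0// ltW.
  have Cv : 0 <= t * `|v| by rewrite mulr_ge0// ltW.
  have tr' : 2 * (t * `|u|) + t * `|v| + t < r.
    by apply: le_lt_trans tr; rewrite le_eqVlt; apply/orP; left; apply/eqP; ring.
  split; first by apply: (le_lt_trans A); lra.
  by apply: (le_lt_trans (ler_normD _ _)); rewrite B; lra.
(* The second difference is [phi t - phi 0]. By the mean value theorem it is t times the increment
   of 'D_u h from z + s u to z + s u + t v, to which the linearisation at z applies. *)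
pose phi (s : R) := h ((z + t *: v) + s *: u) - h (z + s *: u).
pose dphi (s : R) := 'D_u h (z + (s *: u + t *: v)) - 'D_u h (z + s *: u).
have phi' s : 0 <= s <= t -> is_derive s 1 phi (dphi s).
  move=> /small[s1 s2]; have [d1 _] := Hr _ s1; have [d2 _] := Hr _ s2.
  apply: is_deriveB.
    apply/is_derive_lineP; rewrite addrA [z + s *: u + _]addrAC in d2 *.
    by apply: derivableP; exact: diff_derivable.
  by apply/is_derive_lineP; apply: derivableP; exact: diff_derivable.
have phioo s : s \in `]0, t[ -> is_derive s 1 phi (dphi s).
  by rewrite in_itv /= => /andP[/ltW ? /ltW ?]; apply: phi'; apply/andP.
have phic : {within `[0, t], continuous phi}.
  apply/derivable_within_continuous => s; rewrite in_itv /= => st.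
  by have [] := phi' s st.
have [s st Es] := MVT_segment (ltW t0) phioo phic.
have {}st : 0 <= s <= t by move: st; rewrite in_itv.
have [s1 s2] := small s st.
have [_ E1] := Hr _ s1; have [_ E2] := Hr _ s2.
rewrite deriveE// -/L.
have -> : h (z + t *: u + t *: v) - h (z + t *: u) - h (z + t *: v) + h z
    = phi t - phi 0.
  by rewrite /phi scale0r !addr0 [z + t *: v + _]addrAC; ring.
rewrite Es subr0 /dphi.
have LE : L (s *: u + t *: v) - L (s *: u) = t * L v.
  by rewrite linearD /= addrAC subrr add0r linearZ.
set X := 'D_u h (z + (s *: u + t *: v)) in E2 *.
set Y := 'D_u h (z + s *: u) in E1 *.
have -> : (X - Y) * t - t ^+ 2 * L v = t *
   ((X - 'D_u h z - L (s *: u + t *: v)) - (Y - 'D_u h z - L (s *: u))).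
  transitivity (t * (X - Y - (t * L v))); first by ring.
  by rewrite -LE; ring.
rewrite normrM (gtr0_norm t0).
have -> : eps * t ^+ 2 = t * (e * (t * (2 * `|u| + `|v| + 1))).
  by rewrite /e; field; rewrite gt_eqF.
rewrite ler_pM2l//; apply: (le_trans (ler_normB _ _)).
apply: (le_trans (lerD E2 E1)).
rewrite -mulrDr ler_pM2l//.
have /andP[sg0 slt] := st.
have A : `|s *: u| <= t * `|u| by rewrite normrZ ger0_norm// ler_wpM2r.
have B : `|s *: u + t *: v| <= t * `|u| + t * `|v|.
  apply: (le_trans (ler_normD _ _)).
  by rewrite lerD// normrZ gtr0_norm.
by apply: (le_trans (lerD B A)); lra.
Unshelve. all: by end_near. Qed.

(** Exchanging u and v leaves the second difference unchanged, so both mixed derivatives, multiplied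
    by t^2, approximate the same number up to eps t^2 / 2; one small t > 0 then suffices. *)
Lemma derive_comm (R : realType) (V : normedModType R) (h : V -> R)
    (z u v : V) :
  {near z, forall w, differentiable h w} ->
  differentiable (fun w => 'D_u h w) z ->
  differentiable (fun w => 'D_v h w) z ->
  'D_v (fun w => 'D_u h w) z = 'D_u (fun w => 'D_v h w) z.
Proof.
move=> hd ud vd; apply/eqP; rewrite -subr_eq0 -normr_le0.
apply/ler_addgt0Pl => eps eps0; rewrite addr0.
have e0 : 0 < eps / 2 by lra.
have Su := @second_difference _ _ h z u v hd ud _ e0.
have Sv := @second_difference _ _ h z v u hd vd _ e0.
have [t [Hu [Hv t0]]] := filter_ex (filterI Su (filterI Sv (nbhs_right_gt 0))).
have t2 : 0 < t ^+ 2 by rewrite exprn_gt0.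
move: Hu Hv => /=; rewrite [z + t *: v + _]addrAC.
set x := 'D_v _ z; set y := 'D_u (fun w => 'D_v h w) z.
set H := h (z + t *: u + t *: v); set H1 := h (z + t *: u);
  set H2 := h (z + t *: v).
move=> Hu Hv.
suff : `|t ^+ 2 * (x - y)| <= t ^+ 2 * eps.
  by rewrite normrM (gtr0_norm t2) ler_pM2l.
have -> : t ^+ 2 * (x - y) = (H - H2 - H1 + h z - t ^+ 2 * y)
   - (H - H1 - H2 + h z - t ^+ 2 * x) by ring.
apply: (le_trans (ler_normB _ _)).
apply: (le_trans (lerD Hv Hu)).
by rewrite -mulrDl -splitr mulrC.
Qed.

(* Locked, as the conversion test unfolds mixed partial derivatives down to limits
   and may not terminate in practice. *)
Definition pd (R : realType) (V : normedModType R) (i : bool) :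
    (R * R -> V) -> R * R -> V := locked (if i then dx else dy).

Lemma pd_x (R : realType) (V : normedModType R) (h : R * R -> V) :
  pd true h = dx h.
Proof. by rewrite /pd -lock. Qed.

Lemma pd_y (R : realType) (V : normedModType R) (h : R * R -> V) :
  pd false h = dy h.
Proof. by rewrite /pd -lock. Qed.

Lemma eq_on_derive (R : realType) (V W : normedModType R) (D : set V)
    (h k : V -> W) (z v : V) :
  open D -> D z -> (forall w, D w -> h w = k w) -> 'D_v h z = 'D_v k z.
Proof.
move=> oD Dz hk; apply: near_eq_derive.
by apply: (filterS hk); apply: open_nbhs_nbhs.
Qed.

(** The differential of [h] also serves for [k], since the little-o expansion at [z] sees only
    values near [z]. *)
Lemma eq_on_differentiable (R : realType) (V W : normedModType R) (D : set V)
    (h k : V -> W) (z : V) :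
  open D -> D z -> (forall w, D w -> h w = k w) ->
  differentiable h z -> differentiable k z.
Proof.
move=> oD Dz hk dh.
have hk0 : \forall w \near (0 : V), h (w + z) = k (w + z).
  have : \forall w \near z, h w = k w.
    by apply: (filterS hk); apply: open_nbhs_nbhs.
  by rewrite (near_shift 0 z) /=; apply: filterS => x /=; rewrite subr0.
have kE : k \o shift z = cst (k z) + 'd h z +o_ (0 : V) id.
  apply/eqaddoP => e e0.
  have /eqaddoP/(_ _ e0) := diff_locally dh.
  by apply: filterS2 hk0 => x /= xE; rewrite !fctE /= /shift /= xE hk.
apply/diff_locallyP.
by rewrite (diff_unique (diff_continuous dh) kE); split=> //;
  exact: diff_continuous.
Qed.

(** * Calculus of smooth functions on an open set *)

Section Smooth.
Context (R : realType).
Implicit Types (D : set (R * R)) (z : R * R) (i : bool).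

Lemma eq_on_pd (V : normedModType R) D (h k : R * R -> V) i z :
  open D -> D z -> (forall w, D w -> h w = k w) -> pd i h z = pd i k z.
Proof.
by move=> oD Dz hk; case: i; rewrite ?(pd_x, pd_y); exact: eq_on_derive Dz hk.
Qed.

(** The recursion peels off the innermost derivative, whereas [partials] adds the outermost one: the
    rules for sums, products and inverses then go through by induction on the order. *)
Fixpoint smooth_upto (V : normedModType R) D n (h : R * R -> V) : Prop :=
  (forall z, D z -> differentiable h z) /\
  (if n is n'.+1 then forall i, smooth_upto D n' (pd i h) else True).

Lemma smooth_uptoP (V : normedModType R) D (h : R * R -> V) :
  smooth_on D h <-> forall n, smooth_upto D n h.
Proof.
split=> [sh n|sh w].
  elim: n h sh => [|n IH] h sh; split=> //; try by move=> z; exact: (sh [::]).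
  move=> i; apply: IH => w z /(sh (rcons w i)).
  congr (differentiable _ z); elim: w => [|j w /= ->] //.
  by case: i; rewrite ?(pd_x, pd_y).
elim/last_ind: w h sh => [|w i IH] h sh z Dz.
  by have [+ _] := sh 0%N; apply.
have := IH (pd i h) _ z Dz; rewrite (_ : partials w _ = partials (rcons w i) h).
  by apply => n; have [_] := sh n.+1; apply.
by elim: (w) => [|j u /= ->] //; case: i; rewrite ?(pd_x, pd_y).
Qed.

Lemma smooth_uptoW (V : normedModType R) D n (h : R * R -> V) :
  smooth_upto D n.+1 h -> smooth_upto D n h.
Proof.
elim: n h => [|n IH] h [dh sh]; split => //.
by move=> i; apply: IH.
Qed.

Lemma eq_smooth_upto (V : normedModType R) D n (h k : R * R -> V) :
  open D -> (forall w, D w -> h w = k w) ->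
  smooth_upto D n h -> smooth_upto D n k.
Proof.
move=> oD; elim: n h k => [|n IH] h k hk [dh sh]; split=> //;
  try by move=> z Dz; apply: eq_on_differentiable hk (dh z Dz).
move=> i; apply: (IH (pd i h)); last exact: sh.
by move=> w Dw; exact: eq_on_pd Dw hk.
Qed.

Lemma pdE (V : normedModType R) i (h : R * R -> V) z :
  pd i h z = 'D_(if i then (1, 0) else (0, 1)) h z.
Proof. by case: i; rewrite ?(pd_x, pd_y). Qed.

Lemma pdD (h k : R * R -> R) i z : differentiable h z -> differentiable k z ->
  pd i (fun w => h w + k w) z = pd i h z + pd i k z.
Proof. by move=> dh dk; rewrite !pdE; apply: deriveD; exact: diff_derivable. Qed.

Lemma pdB (h k : R * R -> R) i z : differentiable h z -> differentiable k z ->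
  pd i (fun w => h w - k w) z = pd i h z - pd i k z.
Proof. by move=> dh dk; rewrite !pdE; apply: deriveB; exact: diff_derivable. Qed.

Lemma pdM (h k : R * R -> R) i z : differentiable h z -> differentiable k z ->
  pd i (fun w => h w * k w) z = pd i h z * k z + h z * pd i k z.
Proof.
move=> dh dk; rewrite !pdE [RHS]addrC [X in _ + X]mulrC.
by apply: deriveM; exact: diff_derivable.
Qed.

Lemma pdV (h : R * R -> R) i z : differentiable h z -> h z != 0 ->
  pd i (fun w => (h w)^-1) z = - pd i h z * ((h z)^-1 * (h z)^-1).
Proof.
move=> dh h0; rewrite !pdE deriveV//; last exact: diff_derivable.
by rewrite expr2 invfM -[LHS]/(_ * _) mulNr mulNr mulrC.
Qed.

Lemma pd_cst (k : R) i z : pd i (fun _ => k) z = 0.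
Proof. by rewrite pdE derive_cst. Qed.

Lemma smooth_uptoD D n (h k : R * R -> R) : open D ->
  smooth_upto D n h -> smooth_upto D n k -> smooth_upto D n (fun w => h w + k w).
Proof.
move=> oD; elim: n h k => [|n IH] h k [dh sh] [dk sk]; split=> //;
  try by move=> z Dz; apply: differentiableD; [exact: dh|exact: dk].
move=> i; apply: eq_smooth_upto (IH (pd i h) (pd i k) (sh i) (sk i)) => // w Dw.
by rewrite pdD//; [exact: dh|exact: dk].
Qed.

Lemma smooth_uptoN D n (h : R * R -> R) : open D ->
  smooth_upto D n h -> smooth_upto D n (fun w => - h w).
Proof.
move=> oD; elim: n h => [|n IH] h [dh sh]; split=> //;
  try by move=> z Dz; apply: differentiableN; exact: dh.
move=> i; apply: eq_smooth_upto (IH (pd i h) (sh i)) => // w Dw.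
by rewrite !pdE; apply/esym/deriveN/diff_derivable/dh.
Qed.

(** The Leibniz rule leaves one factor undifferentiated, so the induction uses that factor at the
    lower order as well. *)
Lemma smooth_uptoM D n (h k : R * R -> R) : open D ->
  smooth_upto D n h -> smooth_upto D n k -> smooth_upto D n (fun w => h w * k w).
Proof.
move=> oD; elim: n h k => [|n IH] h k sh sk.
  case: sh sk => [dh _] [dk _]; split=> // z Dz.
  by apply: differentiableM; [exact: dh|exact: dk].
have := smooth_uptoW sh; have := smooth_uptoW sk.
case: sh sk => [dh sh] [dk sk] sk' sh'; split=> // [z Dz|i].
  by apply: differentiableM; [exact: dh|exact: dk].
apply: eq_smooth_upto (smooth_uptoD oD (IH _ _ (sh i) sk')
  (IH _ _ sh' (sk i))) => // w Dw.
by rewrite pdM//; [exact: dh|exact: dk].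
Qed.

(** The derivative - h' (1/h)^2 contains 1/h undifferentiated, for which the induction hypothesis
    one order lower is enough. *)
Lemma smooth_uptoV D n (h : R * R -> R) : open D -> (forall z, D z -> h z != 0) ->
  smooth_upto D n h -> smooth_upto D n (fun w => (h w)^-1).
Proof.
move=> oD h0; elim: n => [|n IH] sh.
  case: sh => [dh _]; split=> // z Dz.
  by apply: differentiableV; [exact: dh|exact: h0].
have sV := IH (smooth_uptoW sh).
case: sh => [dh sh]; split=> // [z Dz|i].
  by apply: differentiableV; [exact: dh|exact: h0].
have sVV := smooth_uptoM oD sV sV.
apply: eq_smooth_upto (smooth_uptoM oD (smooth_uptoN oD (sh i)) sVV) => // w Dw.
by rewrite pdV//; [exact: dh|exact: h0].
Qed.

Lemma smooth_on_diff (V : normedModType R) D (h : R * R -> V) z :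
  smooth_on D h -> D z -> differentiable h z.
Proof. by move=> sh; exact: (sh [::]). Qed.

Lemma smooth_on_pd (V : normedModType R) D (h : R * R -> V) i :
  smooth_on D h -> smooth_on D (pd i h).
Proof.
by move=> /smooth_uptoP sh; apply/smooth_uptoP => n; have [_] := sh n.+1; apply.
Qed.

Lemma smooth_onD D (h k : R * R -> R) : open D ->
  smooth_on D h -> smooth_on D k -> smooth_on D (fun w => h w + k w).
Proof.
by move=> oD /smooth_uptoP sh /smooth_uptoP sk; apply/smooth_uptoP => n;
  exact: smooth_uptoD.
Qed.

Lemma smooth_onN D (h : R * R -> R) : open D ->
  smooth_on D h -> smooth_on D (fun w => - h w).
Proof.
by move=> oD /smooth_uptoP sh; apply/smooth_uptoP => n; exact: smooth_uptoN.
Qed.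

Lemma smooth_onM D (h k : R * R -> R) : open D ->
  smooth_on D h -> smooth_on D k -> smooth_on D (fun w => h w * k w).
Proof.
by move=> oD /smooth_uptoP sh /smooth_uptoP sk; apply/smooth_uptoP => n;
  exact: smooth_uptoM.
Qed.

Lemma smooth_onV D (h : R * R -> R) : open D -> (forall z, D z -> h z != 0) ->
  smooth_on D h -> smooth_on D (fun w => (h w)^-1).
Proof.
by move=> oD h0 /smooth_uptoP sh; apply/smooth_uptoP => n; exact: smooth_uptoV.
Qed.

Lemma smooth_on_cst D (k : R) : open D -> smooth_on D (fun=> k).
Proof.
move=> oD; apply/smooth_uptoP => n; elim: n k => [|n IH] k; split=> // i.
by apply: eq_smooth_upto (IH 0) => // w Dw; rewrite pd_cst.
Qed.

Lemma pd_comm D (h : R * R -> R) i j z : open D -> smooth_on D h -> D z ->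
  pd i (pd j h) z = pd j (pd i h) z.
Proof.
move=> oD sh Dz.
have nh : {near z, forall w, differentiable h w}.
  by apply: (filterS (fun w Dw => smooth_on_diff sh Dw)); exact: open_nbhs_nbhs.
have dX : differentiable (dx h) z.
  by rewrite -pd_x; exact: (smooth_on_pd true sh [::]).
have dY : differentiable (dy h) z.
  by rewrite -pd_y; exact: (smooth_on_pd false sh [::]).
have E : dy (dx h) z = dx (dy h) z.
  exact: (@derive_comm R _ h z (1, 0) (0, 1) nh dX dY).
case: i; case: j; rewrite ?(pd_x, pd_y);
  [reflexivity|exact: esym E|exact: E|reflexivity].
Qed.

End Smooth.

(** * Matrix-valued functions *)

Section MatrixDerivative.
Context (R : realType) (V : normedModType R).
Implicit Types (t v : V).

Lemma is_derive_mxP m n (M : V -> 'M[R]_(m, n)) (dM : 'M[R]_(m, n)) t v :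
  is_derive t v M dM <->
  forall i j, is_derive t v (fun x => M x i j) (dM i j).
Proof.
split=> [[Md <-] i j|Md].
  split; first by move/derivable_mxP : (Md); exact.
  by rewrite derive_mx// mxE.
have dM' : derivable M t v by apply/derivable_mxP => i j; have [] := Md i j.
split=> //; rewrite derive_mx//; apply/matrixP => i j; rewrite mxE.
by have [_ ->] := Md i j.
Qed.

Lemma is_derive_bigsum (I : finType) (h : I -> V -> R) (dh : I -> R) t v :
  (forall i, is_derive t v (h i) (dh i)) ->
  is_derive t v (fun x => \sum_i h i x) (\sum_i dh i).
Proof.
move=> hd; rewrite -fct_sumE; elim/big_ind2: _ => [|f df g dg fd gd|i _].
- exact: is_derive_cst.
- exact: is_deriveD.
- exact: hd.
Qed.

Lemma is_derive_mul (f g : V -> R) (df dg : R) t v :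
  is_derive t v f df -> is_derive t v g dg ->
  is_derive t v (fun x => f x * g x) (df * g t + f t * dg).
Proof.
move=> fd gd; apply: is_derive_eq (is_deriveM fd gd) _.
by rewrite addrC -[g t *: df]/(g t * df) mulrC.
Qed.

Lemma is_derive_bigprod (I : finType) (h : I -> V -> R) (dh : I -> R) t v :
  (forall i, is_derive t v (h i) (dh i)) ->
  is_derive t v (fun x => \prod_i h i x)
    (\sum_i dh i * \prod_(j | j != i) h j t).
Proof.
(* Induction over duplicate-free lists: the head does not recur in the tail, so [j != i] removes
   exactly one factor. *)
move=> hd.
suff H (r : seq I) : uniq r -> is_derive t v (fun x => \prod_(i <- r) h i x)
    (\sum_(i <- r) dh i * \prod_(j <- r | j != i) h j t).
  apply: is_derive_eq (H _ (index_enum_uniq I)) _.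
  by apply: eq_bigr.
elim: r => [_|i r IH /= /andP[ir ur]].
  under eq_fun do rewrite big_nil.
  by rewrite big_nil; exact: is_derive_cst.
under eq_fun do rewrite big_cons.
apply: is_derive_eq (is_derive_mul (hd i) (IH ur)) _.
rewrite big_cons big_cons eqxx /= mulr_sumr; congr (_ * _ + _).
  rewrite [RHS]big_seq_cond [LHS]big_seq; apply: eq_bigl => j.
  by case: eqVneq => [->|]; rewrite ?(negPf ir) ?andbT.
rewrite [LHS]big_seq [RHS]big_seq; apply: eq_bigr => j jr.
rewrite big_cons ifT; first by rewrite mulrCA.
by apply: contraNneq ir => ->.
Qed.

Lemma is_derive_mulmx m n k (A : V -> 'M[R]_(m, n)) (B : V -> 'M[R]_(n, k))
    dA dB t v :
  is_derive t v A dA -> is_derive t v B dB ->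
  is_derive t v (fun x => A x *m B x) (dA *m B t + A t *m dB).
Proof.
move=> /is_derive_mxP Ad /is_derive_mxP Bd; apply/is_derive_mxP => i j.
under eq_fun do rewrite mxE.
apply: is_derive_eq (is_derive_bigsum
  (fun l => is_derive_mul (Ad i l) (Bd l j))) _.
by rewrite big_split !mxE.
Qed.

Lemma is_derive_trmx m n (A : V -> 'M[R]_(m, n)) dA t v :
  is_derive t v A dA -> is_derive t v (fun x => (A x)^T) dA^T.
Proof.
move=> /is_derive_mxP Ad; apply/is_derive_mxP => i j.
by under eq_fun do rewrite mxE; rewrite mxE.
Qed.

Lemma is_derive_mxtrace n (A : V -> 'M[R]_n) dA t v :
  is_derive t v A dA -> is_derive t v (fun x => \tr (A x)) (\tr dA).
Proof. by move=> /is_derive_mxP Ad; apply: is_derive_bigsum. Qed.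

(** Jacobi's formula. The Leibniz sum is differentiated one row at a time; the i-th contribution is
    the determinant of [B], where row i of A is replaced by row i of dA, and expansion along that
    row gives a diagonal entry of dA times the adjugate. *)
Lemma is_derive_det n (A : V -> 'M[R]_n) dA t v :
  is_derive t v A dA ->
  is_derive t v (fun x => \det (A x)) (\tr (\adj (A t) *m dA)).
Proof.
move=> /is_derive_mxP Ad.
have dL := is_derive_bigsum (fun s : 'S_n => is_derive_mul
  (is_derive_cst ((-1) ^+ s : R) t v) (is_derive_bigprod (fun i => Ad i (s i)))).
rewrite /determinant; apply: is_derive_eq dL _.
under eq_bigr do rewrite mul0r add0r mulr_sumr.
rewrite exchange_big /= mxtrace_mulC; apply: eq_bigr => i _.
pose B := \matrix_(k, j) (if k == i then dA i j else A t k j).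
transitivity (\det B).
  apply: eq_bigr => s _; congr (_ * _).
  rewrite [in RHS](bigD1 i)//= mxE eqxx; congr (_ * _).
  by apply: eq_bigr => j ji; rewrite mxE (negPf ji).
rewrite (expand_det_row _ i) mxE; apply: eq_bigr => j _.
rewrite !mxE eqxx; congr (_ * _); rewrite /cofactor; congr (_ * \det _).
by apply/matrixP => k l; rewrite !mxE eq_sym (negPf (neq_lift _ _)).
Qed.

End MatrixDerivative.

Section Curves.
Context (R : realType).

Lemma near_det_neq0 n (A : R -> 'M[R]_n) (dA : 'M[R]_n) (t : R) :
  is_derive t 1 A dA -> \det (A t) != 0 -> \forall s \near t, \det (A s) != 0.
Proof.
move=> /is_derive_det[/derivable1_diffP/differentiable_continuous c _] n0.
exact: (c _ (open_nbhs_nbhs (conj (@open_neq _ 0) n0))).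
Qed.

(** Derivability comes from the adjugate formula, valid near t because [invmx] departs from it only
    on singular matrices; the value comes from differentiating A A^-1 = 1. *)
Lemma is_derive_invmx n (A : R -> 'M[R]_n) (dA : 'M[R]_n) (t : R) :
  is_derive t 1 A dA -> A t \in unitmx ->
  is_derive t 1 (fun s => invmx (A s)) (- (invmx (A t) *m dA *m invmx (A t))).
Proof.
move=> Ad At.
have n0 : \det (A t) != 0 by rewrite -unitfE -unitmxE.
have nA := near_det_neq0 Ad n0.
have Vd : derivable (fun s => invmx (A s)) t 1.
  have d1 : derivable (fun s => (\det (A s))^-1 *: \adj (A s)) t 1.
    apply/derivable_mxP => i j.
    under eq_fun do rewrite !mxE.
    apply: derivableM.
      by apply: derivableV => //; have [] := is_derive_det Ad.
    apply: derivableM; first exact: derivable_cst.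
    have Bd : is_derive t 1 (fun s => row' j (col' i (A s))) (row' j (col' i dA)).
      move/is_derive_mxP : Ad => Ad; apply/is_derive_mxP => k l.
      by under eq_fun do rewrite !mxE; rewrite !mxE.
    by have [] := is_derive_det Bd.
  apply: near_eq_derivable d1; apply: filterS nA => s sn.
  by rewrite /invmx unitmxE unitfE sn.
have dV := derivableP Vd.
have E : is_derive t 1 (fun s => A s *m invmx (A s)) 0.
  apply: near_eq_is_derive (is_derive_cst 1%:M t 1).
  by apply: filterS nA => s sn; rewrite mulmxV// unitmxE unitfE.
have [_] := is_derive_mulmx Ad dV; have [_ ->] := E.
move/esym/eqP; rewrite addr_eq0 => /eqP E'.
apply: is_derive_eq dV _.
rewrite -[LHS](mulKmx At).
by move/eqP: E'; rewrite eq_sym eqr_oppLR => /eqP ->; rewrite mulmxN mulmxA.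
Qed.

End Curves.

(** * The Levi-Civita connection of the space of quadrics *)

Section LeviCivita.
Context (R : realType).
Implicit Types s X : 'M[R]_4.

Lemma near_is_derive_uniq (V W : normedModType R) (f g : V -> W) (df dg : W)
    (t v : V) :
  (\forall x \near t, f x = g x) -> is_derive t v f df -> is_derive t v g dg ->
  df = dg.
Proof. by move=> fg fd [_ <-]; have [_ <-] := near_eq_is_derive fg fd. Qed.

(** Chain rule along a curve. It converts an ambient derivative of a field into a derivative along a
    curve in [calQ], where the tangency of the field may be used. *)
Lemma is_derive_comp_curve (V W : normedModType R) (Y : V -> W) (gamma : R -> V)
    (X : V) :
  differentiable Y (gamma 0) -> is_derive (0 : R) 1 gamma X ->
  is_derive (0 : R) 1 (fun t => Y (gamma t)) ('D_X Y (gamma 0)).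
Proof.
move=> dY [/derivable1_diffP dg gX].
have dc : differentiable (Y \o gamma) (0 : R) by exact: differentiable_comp.
split; first by exact/derivable1_diffP.
by rewrite (deriveE _ dc) diff_comp//= -(deriveE _ dg) gX deriveE.
Qed.

Lemma calQ_unitmx s : calQ s -> s \in unitmx.
Proof. by case=> _ d1 _; rewrite unitmxE d1 unitr1. Qed.

(** On [calQ] the determinant is 1, so the adjugate in Jacobi's formula is the inverse. *)
Lemma tangentP s X : calQ s ->
  tangent s X <-> X^T = X /\ \tr (invmx s *m X) = 0.
Proof.
move=> sQ.
suff -> : \tr (invmx s *m X) = 'D_X (fun s' : 'M[R]_4 => \det s') s by [].
have [_ ->] := is_derive_det (is_derive_id s X).
by rewrite /invmx (calQ_unitmx sQ); case: sQ => _ -> _; rewrite invr1 scale1r.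
Qed.

Lemma calQ_congr s (g : 'M[R]_4) : calQ s -> \det g = 1 -> calQ (g *m s *m g^T).
Proof.
case=> sT d1 [h hu sE] g1; split.
- by rewrite !trmx_mul trmxK sT mulmxA.
- by rewrite !det_mulmx det_tr g1 d1 !mulr1.
- exists (g *m h); last by rewrite sE trmx_mul !mulmxA.
  by rewrite unitmx_mul hu unitmxE g1 unitr1.
Qed.

(* gamma = E s E^T, where E = (1 + tA) diag(1/det(1 + tA), 1, 1, 1) with
   A = X s^-1 / 2 has determinant 1 and E'(0) = A because tr A = 0. *)
Lemma calQ_curve s X : calQ s -> tangent s X ->
  exists gamma : R -> 'M[R]_4, [/\ gamma 0 = s, is_derive (0 : R) 1 gamma X &
    \forall t \near (0 : R), calQ (gamma t)].
Proof.
move=> sQ /(tangentP X sQ)[XT X0].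
have su := calQ_unitmx sQ.
pose A := 2^-1 *: (X *m invmx s).
have trA : \tr A = 0 by rewrite linearZ /= mxtrace_mulC X0 mulr0.
pose M (t : R) : 'M[R]_4 := 1%:M + t *: A.
have Md : is_derive (0 : R) 1 M A.
  apply/(is_derive_lineP id); exact: is_derive_id.
have M0 : M 0 = 1%:M by rewrite /M scale0r addr0.
pose d (t : R) : 'rV[R]_4 := \row_j (if j == 0 then (\det (M t))^-1 else 1).
have dd : is_derive (0 : R) 1 (fun t => diag_mx (d t)) 0.
  apply/is_derive_mxP => i j; under eq_fun do rewrite !mxE.
  rewrite mxE; case: eqVneq => _; last exact: is_derive_cst.
  case: eqVneq => _; last exact: is_derive_cst.
  have [Dd De] := is_derive_det Md; split.
    by apply: derivableV => //; rewrite M0 det1 oner_neq0.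
  rewrite deriveV ?M0 ?det1 ?oner_neq0//.
  by rewrite De M0 adj1 mul1mx trA scaler0.
pose E t := M t *m diag_mx (d t).
have d0 : diag_mx (d 0) = 1%:M.
  by apply/matrixP => i j; rewrite !mxE M0 det1 invr1 if_same.
have Ed : is_derive (0 : R) 1 E A.
  by apply: is_derive_eq (is_derive_mulmx Md dd) _;
    rewrite d0 mulmx1 mulmx0 addr0.
have E0 : E 0 = 1%:M by rewrite /E M0 d0 mulmx1.
exists (fun t => E t *m s *m (E t)^T); split.
- by rewrite E0 mul1mx trmx1 mulmx1.
- have sd : is_derive (0 : R) 1 (fun _ : R => s) 0 by exact: is_derive_cst.
  have gd := is_derive_mulmx (is_derive_mulmx Ed sd) (is_derive_trmx Ed).
  apply: is_derive_eq gd _.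
  rewrite E0 trmx1 mulmx1 mulmx0 addr0 mul1mx /A linearZ /= trmx_mul XT trmx_inv.
  have -> : s^T = s by case: sQ.
  rewrite -scalemxAl -scalemxAr mulmxKV// mulKVmx//.
  by rewrite -scalerDl -[2^-1]mul1r -splitr scale1r.
- have M0n : \det (M 0) != 0 by rewrite M0 det1 oner_neq0.
  apply: filterS (near_det_neq0 Md M0n) => t tn; apply: calQ_congr => //.
  rewrite /E det_mulmx det_diag (bigD1 0)//= big1 ?mulr1; last first.
    by move=> i /negPf i0; rewrite mxE i0.
  by rewrite mxE eqxx mulfV.
Qed.

(** Each of the two factors s^-1 in the metric has derivative - s^-1 X s^-1 along X. The symmetrised
    half-sum compensates both, and its symmetry in X and Y gives vanishing torsion. *)
Definition lc_tensor s X (Y : 'M[R]_4) : 'M[R]_4 :=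
  2^-1 *: (X *m invmx s *m Y + Y *m invmx s *m X).

Lemma lc_connection : connection lc_tensor.
Proof.
split.
- move=> s a X X' Y _ _ _ _; rewrite /lc_tensor !mulmxDl !mulmxDr.
  rewrite -!scalemxAl -!scalemxAr scalerA mulrC -scalerA -scalerDr.
  by rewrite scalerDr addrACA -!scalerDr.
- move=> s a X Y Y' _ _ _ _; rewrite /lc_tensor !mulmxDl !mulmxDr.
  rewrite -!scalemxAl -!scalemxAr scalerA mulrC -scalerA -scalerDr.
  by rewrite scalerDr addrACA -!scalerDr.
- move=> s X Y sQ Xt Yf; apply/tangentP => //.
  have [gamma [g0 gd gQ]] := calQ_curve sQ Xt.
  have [Yd Yt] := Yf _ sQ.
  have [XT X0] := (tangentP X sQ).1 Xt.
  have [YT Y0] := (tangentP (Y s) sQ).1 Yt.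
  have su := calQ_unitmx sQ.
  have sT : s^T = s by case: sQ.
  have Ygd : is_derive (0 : R) 1 (fun t => Y (gamma t)) ('D_X Y s).
    by have := @is_derive_comp_curve _ _ Y gamma X; rewrite g0; apply.
  have Vd : is_derive (0 : R) 1 (fun t => invmx (gamma t))
      (- (invmx s *m X *m invmx s)).
    by rewrite -g0; apply: is_derive_invmx; rewrite ?g0.
  split.
    have ST : ('D_X Y s)^T = 'D_X Y s.
      apply: near_is_derive_uniq (is_derive_trmx Ygd) Ygd.
      apply: filterS gQ => t tQ.
      by have [_ /(tangentP _ tQ)[]] := Yf _ tQ.
    rewrite /covd /lc_tensor linearB linearZ /= linearD /= !trmx_mul trmx_inv sT
      ST XT YT.
    by rewrite !mulmxA [X in _ *: X]addrC.
  (* The trace condition holds along [gamma], so its derivative is zero and tr (s^-1 D_X Y) = tr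
     (s^-1 X s^-1 Y). Both terms of [lc_tensor] have this same trace against s^-1, by cyclicity. *)
  have T0 : is_derive (0 : R) 1 (fun t => \tr (invmx (gamma t) *m Y (gamma t))) 0.
    apply: near_eq_is_derive (is_derive_cst (0 : R) (0 : R) 1).
    apply: filterS gQ => t tQ.
    by have [_ /(tangentP _ tQ)[_ ->]] := Yf _ tQ.
  have [_] := is_derive_mxtrace (is_derive_mulmx Vd Ygd); have [_ ->] := T0.
  rewrite g0 mxtraceD mulNmx linearN /= => /esym/eqP;
    rewrite addrC subr_eq0 => /eqP E.
  rewrite /covd /lc_tensor mulmxBr linearB /= E -scalemxAr mulmxDr linearZ
    linearD /=.
  have -> : \tr (invmx s *m (Y s *m invmx s *m X))
          = \tr (invmx s *m (X *m invmx s *m Y s)).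
    by rewrite !mulmxA -[in LHS]mulmxA mxtrace_mulC !mulmxA.
  by rewrite !mulmxA; set T := \tr _; field.
Qed.

Lemma lc_torsion_free : torsion_free lc_tensor.
Proof.
move=> X Y s _ _ _; rewrite /covd /lc_tensor [Y s *m _ *m _ + _]addrC.
by rewrite opprB addrA subrK.
Qed.

Lemma lc_metric_compatible : metric_compatible lc_tensor.
Proof.
move=> X Y Z s sQ Xt Yf Zf.
have su := calQ_unitmx sQ.
have [[Yd _] [Zd _]] := (Yf _ sQ, Zf _ sQ).
(* A straight line may leave [calQ], which is harmless here: the left side is an ambient derivative
   at s, computed by the product rule without any identity special to [calQ]. *)
pose gamma (t : R) := s + t *: X.
have g0 : gamma 0 = s by rewrite /gamma scale0r addr0.
have gd : is_derive (0 : R) 1 gamma X.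
  apply/(is_derive_lineP id); exact: is_derive_id.
have Ygd : is_derive (0 : R) 1 (fun t => Y (gamma t)) ('D_X Y s).
  by have := @is_derive_comp_curve _ _ Y gamma X; rewrite g0; apply.
have Zgd : is_derive (0 : R) 1 (fun t => Z (gamma t)) ('D_X Z s).
  by have := @is_derive_comp_curve _ _ Z gamma X; rewrite g0; apply.
have Vd : is_derive (0 : R) 1 (fun t => invmx (gamma t))
    (- (invmx s *m X *m invmx s)).
  by rewrite -g0; apply: is_derive_invmx; rewrite ?g0.
have VYVd := is_derive_mulmx (is_derive_mulmx Vd Ygd) Vd.
have := is_derive_mxtrace (is_derive_mulmx VYVd Zgd).
rewrite (is_derive_lineP (fun w => metric w (Y w) (Z w)) s X 0) scale0r addr0.
case=> _ ->.
rewrite g0 /metric /covd /lc_tensor.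
set S := invmx s.
set DY := 'D_X Y s; set DZ := 'D_X Z s; set y := Y s; set z := Z s.
rewrite !(mulmxDl, mulmxDr, mulmxN, mulNmx, mulmxBl, mulmxBr).
rewrite -!(scalemxAl, scalemxAr).
rewrite !(mulmxDl, mulmxDr, mulmxN, mulNmx, mulmxBl, mulmxBr).
have trN (A : 'M[R]_4) : \tr (- A) = - \tr A by rewrite linearN.
rewrite !(mxtraceD, trN, mxtraceZ) !mulmxA.
have -> : \tr (S *m y *m S *m z *m S *m X) = \tr (S *m X *m S *m y *m S *m z).
  by rewrite -[S *m y *m S *m z *m S *m X]mulmxA mxtrace_mulC !mulmxA.
by field.
Qed.

Lemma lc_levi_civita : levi_civita lc_tensor.
Proof.
split; [exact: lc_connection|exact: lc_torsion_free|exact: lc_metric_compatible].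
Qed.

End LeviCivita.

(** * The Wilczynski frame *)

Section CanonicalSystem.
Context (R : realType) (D : set (R * R)) (oD : open D).
Implicit Types (z : R * R) (h k : R * R -> R).

Lemma pd_onD h k i z : smooth_on D h -> smooth_on D k -> D z ->
  pd i (fun w => h w + k w) z = pd i h z + pd i k z.
Proof. by move=> sh sk Dz; apply: pdD; exact: smooth_on_diff Dz. Qed.

Lemma pd_onB h k i z : smooth_on D h -> smooth_on D k -> D z ->
  pd i (fun w => h w - k w) z = pd i h z - pd i k z.
Proof. by move=> sh sk Dz; apply: pdB; exact: smooth_on_diff Dz. Qed.

Lemma pd_onM h k i z : smooth_on D h -> smooth_on D k -> D z ->
  pd i (fun w => h w * k w) z = pd i h z * k z + h z * pd i k z.
Proof. by move=> sh sk Dz; apply: pdM; exact: smooth_on_diff Dz. Qed.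

Ltac smooth := solve [repeat first [assumption | apply: smooth_on_pd
  | apply: (smooth_on_cst _ oD) | apply: (smooth_onM oD)
  | apply: (smooth_onN oD) | apply: (smooth_onD oD)]].

Ltac expand_pd := repeat first [rewrite pd_cst
  | rewrite pd_onM; [|smooth|smooth|assumption]
  | rewrite pd_onB; [|smooth|smooth|assumption]
  | rewrite pd_onD; [|smooth|smooth|assumption]].

(* [ring], [field] and [lra] are slow at telling partial derivatives apart. *)
Ltac generalize_pd := repeat
  match goal with
  | |- context [@pd ?S ?V ?i ?h ?z] => generalize (@pd S V i h z); intro
  end.

Local Notation X := (pd true).
Local Notation Y := (pd false).

Context (b c p q : R * R -> R).
Context (sb : smooth_on D b) (sc : smooth_on D c) (sp : smooth_on D p)
  (sq : smooth_on D q).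

Section Lift.
Context (h : R * R -> R) (sh : smooth_on D h).
Context (hxx : forall z, D z -> X (X h) z = b z * Y h z + p z * h z).
Context (hyy : forall z, D z -> Y (Y h) z = c z * X h z + q z * h z).

Lemma lift_yx z : D z -> X (Y h) z = Y (X h) z.
Proof. by move=> Dz; apply: pd_comm oD sh Dz. Qed.

(** h_xyx is the y-derivative of the first canonical equation, in which the second one replaces
    h_yy. *)
Lemma lift_xyx z : D z -> X (Y (X h)) z =
  Y b z * Y h z + b z * (c z * X h z + q z * h z) + Y p z * h z + p z * Y h z.
Proof.
move=> Dz; rewrite (pd_comm true false oD (smooth_on_pd true sh) Dz).
rewrite (eq_on_pd false oD Dz hxx); expand_pd; rewrite hyy//.
by generalize_pd; ring.
Qed.

Lemma lift_yyx z : D z -> Y (Y (X h)) z =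
  X c z * X h z + c z * (b z * Y h z + p z * h z) + X q z * h z + q z * X h z.
Proof.
move=> Dz; rewrite -(eq_on_pd false oD Dz lift_yx).
rewrite (pd_comm false true oD (smooth_on_pd false sh) Dz).
rewrite (eq_on_pd true oD Dz hyy); expand_pd; rewrite hxx//.
by generalize_pd; ring.
Qed.

(* The coefficients of h_xy in h_xyxy and h_xyyx agree. *)
Lemma lift_integrability z : D z ->
  (2 * Y b z * q z + b z * Y q z + Y (Y p) z
     - 2 * X c z * p z - c z * X p z - X (X q) z) * h z
  + (2 * Y b z * c z + b z * Y c z - X (X c) z - 2 * X q z) * X h z
  + (Y (Y b) z + 2 * Y p z - 2 * b z * X c z - c z * X b z) * Y h z = 0.
Proof.
move=> Dz.
have := pd_comm true false oD (smooth_on_pd false (smooth_on_pd true sh)) Dz.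
rewrite (eq_on_pd true oD Dz lift_yyx) (eq_on_pd false oD Dz lift_xyx).
expand_pd; rewrite (lift_yx Dz) (hxx Dz) (hyy Dz) => /eqP.
rewrite eq_sym -subr_eq0 => /eqP <-.
by generalize_pd; ring.
Qed.

End Lift.

(** Only these relations characterise a and e here, so the frame equations are polynomial identities
    and no quotient c_x / 2c is ever differentiated. *)
Context (a e : R * R -> R) (sa : smooth_on D a) (se : smooth_on D e).
Context (c_x : forall z, D z -> X c z = 2 * a z * c z).
Context (b_y : forall z, D z -> Y b z = 2 * e z * b z).

Definition frame1 h z : R := X h z - a z * h z.
Definition frame2 h z : R := Y h z - e z * h z.
Definition frame3 h z : R :=
  Y (X h) z - a z * Y h z - e z * X h z + (e z * a z - b z * c z / 2) * h z.

(* With a = c_x/2c and e = b_y/2b these are the invariants P and Q. *)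
Definition coefP z : R := p z + b z * e z - X a z - a z * a z.
Definition coefQ z : R := q z + c z * a z - Y e z - e z * e z.
Definition coefk z : R := b z * c z / 2 - X e z.
Definition coefl z : R := b z * c z / 2 - Y a z.

(** The compatibility conditions, obtained for an actual lift from [lift_integrability]. They
    eliminate p_y and q_x, which enter the derivatives of [frame3] through [lift_xyx] and
    [lift_yyx]. *)
Context (p_y : forall z, D z ->
  Y (Y b) z + 2 * Y p z = 2 * b z * X c z + c z * X b z).
Context (q_x : forall z, D z ->
  2 * Y b z * c z + b z * Y c z = X (X c) z + 2 * X q z).

Lemma byy z : D z -> Y (Y b) z = 2 * (Y e z * b z + e z * Y b z).
Proof. by move=> Dz; rewrite (eq_on_pd false oD Dz b_y); expand_pd; ring. Qed.

Lemma cxx z : D z -> X (X c) z = 2 * (X a z * c z + a z * X c z).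
Proof. by move=> Dz; rewrite (eq_on_pd true oD Dz c_x); expand_pd; ring. Qed.

Lemma pyE z : D z ->
  Y p z = b z * X c z + c z * X b z / 2 - (Y e z * b z + e z * Y b z).
Proof.
by move=> Dz; have := p_y Dz; rewrite byy//; generalize_pd => E; lra.
Qed.

Lemma qxE z : D z ->
  X q z = c z * Y b z + b z * Y c z / 2 - (X a z * c z + a z * X c z).
Proof. by move=> Dz; have := q_x Dz; rewrite cxx//; generalize_pd => E; lra. Qed.

Section FrameEquations.
Context (h : R * R -> R) (sh : smooth_on D h).
Context (hxx : forall z, D z -> X (X h) z = b z * Y h z + p z * h z).
Context (hyy : forall z, D z -> Y (Y h) z = c z * X h z + q z * h z).
Notation W1 := (frame1 h).
Notation W2 := (frame2 h).
Notation W3 := (frame3 h).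

Lemma frame0_x z : X h z = a z * h z + W1 z.
Proof. by rewrite /frame1; ring. Qed.

Lemma frame0_y z : Y h z = e z * h z + W2 z.
Proof. by rewrite /frame2; ring. Qed.

Lemma frame1_x z : D z -> X W1 z = coefP z * h z - a z * W1 z + b z * W2 z.
Proof.
move=> Dz; rewrite /W1; expand_pd; rewrite hxx// /frame1 /frame2 /coefP.
by generalize_pd; ring.
Qed.

Lemma frame1_y z : D z -> Y W1 z = coefl z * h z + e z * W1 z + W3 z.
Proof.
move=> Dz; rewrite /W1; expand_pd; rewrite /frame1 /frame3 /coefl.
by generalize_pd; field.
Qed.

Lemma frame2_x z : D z -> X W2 z = coefk z * h z + a z * W2 z + W3 z.
Proof.
move=> Dz; rewrite /W2; expand_pd; rewrite lift_yx// /frame2 /frame3 /coefk.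
by generalize_pd; field.
Qed.

Lemma frame2_y z : D z -> Y W2 z = coefQ z * h z + c z * W1 z - e z * W2 z.
Proof.
move=> Dz; rewrite /W2; expand_pd; rewrite hyy// /frame1 /frame2 /coefQ.
by generalize_pd; ring.
Qed.

Lemma frame3_x z : D z -> X W3 z =
  b z * coefQ z * h z + coefk z * W1 z + coefP z * W2 z - a z * W3 z.
Proof.
move=> Dz; rewrite /W3; expand_pd.
rewrite (lift_xyx sh hxx hyy Dz) (lift_yx sh Dz) (hxx Dz) (pyE Dz) (c_x Dz)
  (b_y Dz).
rewrite /frame1 /frame2 /frame3 /coefk /coefP /coefQ.
by generalize_pd; field.
Qed.

Lemma frame3_y z : D z -> Y W3 z =
  c z * coefP z * h z + coefQ z * W1 z + coefl z * W2 z - e z * W3 z.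
Proof.
move=> Dz; rewrite /W3; expand_pd.
rewrite (lift_yyx sh hxx hyy Dz) (hyy Dz) (qxE Dz) (c_x Dz) (b_y Dz).
rewrite /frame1 /frame2 /frame3 /coefl /coefP /coefQ.
by generalize_pd; field.
Qed.

Lemma smooth_frame1 : smooth_on D W1. Proof. by smooth. Qed.
Lemma smooth_frame2 : smooth_on D W2. Proof. by smooth. Qed.
Lemma smooth_frame3 : smooth_on D W3. Proof. by smooth. Qed.
Lemma smooth_coefl : smooth_on D coefl. Proof. by smooth. Qed.

(* The coefficient of h in (W1)_xy = (W1)_yx; all the others agree. *)
Lemma coefl_x_lift z : (forall w, D w -> coefP w = 0) -> D z ->
  (X coefl z + 2 * a z * coefl z) * h z = 0.
Proof.
move=> P0 Dz; have kl : coefk z = b z * c z - X e z - Y a z - coefl z.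
  by rewrite /coefk /coefl; field.
have F1x w : D w -> X W1 w = b w * W2 w - a w * W1 w.
  by move=> Dw; rewrite frame1_x// P0//; ring.
have F2y := frame2_y Dz.
have F3x : X W3 z = b z * coefQ z * h z + coefk z * W1 z - a z * W3 z.
  by rewrite frame3_x// P0//; ring.
have F0x := frame0_x z.
move: smooth_frame1 smooth_frame2 smooth_frame3 smooth_coefl kl F1x frame1_y F2y
  F3x F0x.
move: W1 W2 W3 coefl (coefk z) (coefQ z) => w1 w2 w3 l kz Qz.
move=> s1 s2 s3 sl kl F1x F1y F2y F3x F0x.
have := pd_comm true false oD s1 Dz.
rewrite (eq_on_pd true oD Dz F1y) (eq_on_pd false oD Dz F1x); expand_pd.
rewrite F3x F1x// F1y// F2y F0x (b_y Dz) kl => /eqP.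
rewrite -subr_eq0 => /eqP <-; ring.
Qed.

End FrameEquations.
End CanonicalSystem.

(** * Explicit matrix identities and congruence by the frame *)

Section Matrices.
Context (R : realType).
Implicit Types (a b c e k l P Q : R).

(** Nested lists let products, sums and transposes be computed on symbolic entries, so that a matrix
    identity splits into sixteen scalar ones. *)
Definition mx4 (s : seq (seq R)) : 'M[R]_4 :=
  \matrix_(i, j) (nth [::] s i)`_j.

(* The matrices U, V, A and B are [frame_Ux], [frame_Uy], [gauss_Ux] and
   [gauss_Uy]. *)
Definition frame_Ux a b P Q k : 'M[R]_4 := mx4
  [:: [:: a; P; k; b * Q]; [:: 1; - a; 0; k]; [:: 0; b; a; P]; [:: 0; 0; 1; - a]].

Definition frame_Uy e c P Q l : 'M[R]_4 := mx4
  [:: [:: e; l; Q; c * P]; [:: 0; e; c; Q]; [:: 1; 0; - e; l]; [:: 0; 1; 0; - e]].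

Definition gauss_Ux b P Q k : 'M[R]_4 := mx4
  [:: [:: 0; 2 * P; 2 * k; 2 * (b * Q)]; [:: 2; 0; 0; 2 * k];
      [:: 0; 2 * b; 0; 2 * P]; [:: 0; 0; 2; 0]].

Definition gauss_Uy c P Q l : 'M[R]_4 := mx4
  [:: [:: 0; 2 * l; 2 * Q; 2 * (c * P)]; [:: 0; 0; 2 * c; 2 * Q];
      [:: 2; 0; 0; 2 * l]; [:: 0; 2; 0; 0]].

Ltac entries4 := apply/matrixP;
  case=> [[|[|[|[|//]]]] ?]; case=> [[|[|[|[|//]]]] ?]; rewrite !mxE.

Lemma mx4_mul (x00 x01 x02 x03 x10 x11 x12 x13 x20 x21 x22 x23 x30 x31 x32 x33
    y00 y01 y02 y03 y10 y11 y12 y13 y20 y21 y22 y23 y30 y31 y32 y33 : R) :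
  mx4 [:: [:: x00; x01; x02; x03]; [:: x10; x11; x12; x13];
          [:: x20; x21; x22; x23]; [:: x30; x31; x32; x33]] *m
  mx4 [:: [:: y00; y01; y02; y03]; [:: y10; y11; y12; y13];
          [:: y20; y21; y22; y23]; [:: y30; y31; y32; y33]] =
  mx4
  [:: [:: x00 * y00 + x01 * y10 + x02 * y20 + x03 * y30;
          x00 * y01 + x01 * y11 + x02 * y21 + x03 * y31;
          x00 * y02 + x01 * y12 + x02 * y22 + x03 * y32;
          x00 * y03 + x01 * y13 + x02 * y23 + x03 * y33];
      [:: x10 * y00 + x11 * y10 + x12 * y20 + x13 * y30;
          x10 * y01 + x11 * y11 + x12 * y21 + x13 * y31;
          x10 * y02 + x11 * y12 + x12 * y22 + x13 * y32;
          x10 * y03 + x11 * y13 + x12 * y23 + x13 * y33];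
      [:: x20 * y00 + x21 * y10 + x22 * y20 + x23 * y30;
          x20 * y01 + x21 * y11 + x22 * y21 + x23 * y31;
          x20 * y02 + x21 * y12 + x22 * y22 + x23 * y32;
          x20 * y03 + x21 * y13 + x22 * y23 + x23 * y33];
      [:: x30 * y00 + x31 * y10 + x32 * y20 + x33 * y30;
          x30 * y01 + x31 * y11 + x32 * y21 + x33 * y31;
          x30 * y02 + x31 * y12 + x32 * y22 + x33 * y32;
          x30 * y03 + x31 * y13 + x32 * y23 + x33 * y33]].
Proof. by entries4; rewrite !big_ord_recl big_ord0 !mxE addr0 !addrA. Qed.

Lemma mx4_add (x00 x01 x02 x03 x10 x11 x12 x13 x20 x21 x22 x23 x30 x31 x32 x33
    y00 y01 y02 y03 y10 y11 y12 y13 y20 y21 y22 y23 y30 y31 y32 y33 : R) :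
  mx4 [:: [:: x00; x01; x02; x03]; [:: x10; x11; x12; x13];
          [:: x20; x21; x22; x23]; [:: x30; x31; x32; x33]] +
  mx4 [:: [:: y00; y01; y02; y03]; [:: y10; y11; y12; y13];
          [:: y20; y21; y22; y23]; [:: y30; y31; y32; y33]] =
  mx4
  [:: [:: x00 + y00; x01 + y01; x02 + y02; x03 + y03];
      [:: x10 + y10; x11 + y11; x12 + y12; x13 + y13];
      [:: x20 + y20; x21 + y21; x22 + y22; x23 + y23];
      [:: x30 + y30; x31 + y31; x32 + y32; x33 + y33]].
Proof. by entries4. Qed.

Lemma mx4_scale t
    (x00 x01 x02 x03 x10 x11 x12 x13 x20 x21 x22 x23 x30 x31 x32 x33 : R) :
  t *: mx4 [:: [:: x00; x01; x02; x03]; [:: x10; x11; x12; x13];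
               [:: x20; x21; x22; x23]; [:: x30; x31; x32; x33]] =
  mx4
  [:: [:: t * x00; t * x01; t * x02; t * x03];
      [:: t * x10; t * x11; t * x12; t * x13];
      [:: t * x20; t * x21; t * x22; t * x23];
      [:: t * x30; t * x31; t * x32; t * x33]].
Proof. by entries4. Qed.

Lemma mx4_tr
    (x00 x01 x02 x03 x10 x11 x12 x13 x20 x21 x22 x23 x30 x31 x32 x33 : R) :
  (mx4 [:: [:: x00; x01; x02; x03]; [:: x10; x11; x12; x13];
           [:: x20; x21; x22; x23]; [:: x30; x31; x32; x33]])^T =
  mx4
  [:: [:: x00; x10; x20; x30];
      [:: x01; x11; x21; x31];
      [:: x02; x12; x22; x32];
      [:: x03; x13; x23; x33]].
Proof. by entries4. Qed.

Lemma mx4_trace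
    (x00 x01 x02 x03 x10 x11 x12 x13 x20 x21 x22 x23 x30 x31 x32 x33 : R) :
  \tr (mx4 [:: [:: x00; x01; x02; x03]; [:: x10; x11; x12; x13];
               [:: x20; x21; x22; x23]; [:: x30; x31; x32; x33]])
  = x00 + x11 + x22 + x33.
Proof. by rewrite /mxtrace !big_ord_recl big_ord0 !mxE addr0 !addrA. Qed.

Lemma J1_mx4 : J1 = mx4
  [:: [:: 0; 0; 0; 1]; [:: 0; 0; 1; 0]; [:: 0; 1; 0; 0]; [:: 1; 0; 0; 0]].
Proof. by entries4. Qed.

Lemma id_mx4 : 1%:M = mx4
  [:: [:: 1; 0; 0; 0]; [:: 0; 1; 0; 0]; [:: 0; 0; 1; 0]; [:: 0; 0; 0; 1]].
Proof. by entries4. Qed.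

Ltac expand_mx4 := rewrite ?(J1_mx4, id_mx4) ?(mx4_tr, mx4_mul, mx4_scale,
  mx4_add).
Ltac congr_mx4 := congr (mx4 [:: [:: _; _; _; _]; [:: _; _; _; _];
                                [:: _; _; _; _]; [:: _; _; _; _]]).

Lemma trmx_J1 : (@J1 R)^T = J1.
Proof. by apply/matrixP => i j; rewrite !mxE addnC. Qed.

Lemma mul_J1_J1 : @J1 R *m J1 = 1%:M.
Proof. by expand_mx4; congr_mx4; ring. Qed.

Lemma det_J1 : \det (@J1 R) = 1.
Proof.
have -> : @J1 R =
    perm_mx (tperm (inord 0) (inord 3) * tperm (inord 1) (inord 2))%g.
  apply/matrixP => i j; rewrite !mxE permM !permE /=.
  by move: i j; case=> [[|[|[|[|//]]]] ?]; case=> [[|[|[|[|//]]]] ?];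
    do ![rewrite -!val_eqE /= ?inordK//= | rewrite permE /=].
by rewrite det_perm odd_permM !odd_tperm -!val_eqE /= !inordK//.
Qed.

Lemma signature22_J1 : signature22 (@J1 R).
Proof.
(* J_1 is the sum of u v^t + v u^t over the pairs (e_0, e_3) and (e_1, e_2). Each summand is w w^t -
   w' w'^t with w = u + v/2 and w' = u - v/2; these vectors are the columns, and the halves avoid a
   square root of 2. *)
exists (mx4 [:: [:: 1; 0; 1; 0]; [:: 0; 1; 0; 1]; [:: 0; 2^-1; 0; - 2^-1];
                [:: 2^-1; 0; - 2^-1; 0]]).
  suff : mx4 [:: [:: 1; 0; 1; 0]; [:: 0; 1; 0; 1]; [:: 0; 2^-1; 0; - 2^-1];
                 [:: 2^-1; 0; - 2^-1; 0]] *m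
         mx4 [:: [:: 2^-1; 0; 0; 1]; [:: 0; 2^-1; 1; 0];
                 [:: 2^-1; 0; 0; -1]; [:: 0; 2^-1; -1; 0]] = 1%:M.
    by case/mulmx1_unit.
  by expand_mx4; congr_mx4; field.
have -> : (block_mx 1%:M 0 0 (- 1%:M) : 'M[R]_(2 + 2)) = mx4
    [:: [:: 1; 0; 0; 0]; [:: 0; 1; 0; 0]; [:: 0; 0; -1; 0]; [:: 0; 0; 0; -1]].
  apply/matrixP => i j; rewrite !mxE.
  case: (splitP i) => i' ->; rewrite mxE; case: (splitP j) => j' ->; rewrite !mxE;
  case: i' => [[|[|//]] ?]; case: j' => [[|[|//]] ?] /=;
    rewrite ?mulr1n ?mulr0n ?oppr0//.
by expand_mx4; congr_mx4; field.
Qed.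

Lemma calQ_J1 : calQ (@J1 R).
Proof. by split; [exact: trmx_J1|exact: det_J1|exact: signature22_J1]. Qed.

Lemma frame_Ux_sym a b P Q k :
  frame_Ux a b P Q k *m J1 + J1 *m (frame_Ux a b P Q k)^T
  = gauss_Ux b P Q k *m J1.
Proof. by expand_mx4; congr_mx4; ring. Qed.

Lemma frame_Uy_sym e c P Q l :
  frame_Uy e c P Q l *m J1 + J1 *m (frame_Uy e c P Q l)^T
  = gauss_Uy c P Q l *m J1.
Proof. by expand_mx4; congr_mx4; ring. Qed.

Lemma gauss_Ux_trace b P Q k :
  \tr (gauss_Ux b P Q k *m gauss_Ux b P Q k) = 16 * P.
Proof.
by expand_mx4; rewrite mx4_trace; ring.
Qed.

Lemma gauss_Uy_trace c P Q l :
  \tr (gauss_Uy c P Q l *m gauss_Uy c P Q l) = 16 * Q.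
Proof.
by expand_mx4; rewrite mx4_trace; ring.
Qed.

(** The harmonic map equation with the outer factors F and J_1 F^t removed. The literal matrix is
    the x-derivative of [gauss_Uy c 0 0 l] after inserting c_x = 2ac and l_x = -2al. *)
Lemma demoulin_tension a b c k l :
  frame_Ux a b 0 0 k *m gauss_Uy c 0 0 l
    + mx4 [:: [:: 0; 2 * (- (2 * a * l)); 0; 0]; [:: 0; 0; 2 * (2 * a * c); 0];
              [:: 0; 0; 0; 2 * (- (2 * a * l))]; [:: 0; 0; 0; 0]]
    + gauss_Uy c 0 0 l *m (gauss_Ux b 0 0 k - frame_Ux a b 0 0 k)
  = 2^-1 *: (gauss_Ux b 0 0 k *m gauss_Uy c 0 0 l
             + gauss_Uy c 0 0 l *m gauss_Ux b 0 0 k).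
Proof.
have -> : gauss_Ux b 0 0 k - frame_Ux a b 0 0 k = mx4
  [:: [:: - a; 0; k; 0]; [:: 1; a; 0; k]; [:: 0; b; - a; 0]; [:: 0; 0; 1; a]].
  by apply/eqP; rewrite subr_eq; apply/eqP; expand_mx4; congr_mx4; ring.
by expand_mx4; congr_mx4; field.
Qed.

Lemma invmx_frame (F : 'M[R]_4) : F \in unitmx ->
  invmx (F *m J1 *m F^T) = (invmx F)^T *m J1 *m invmx F.
Proof.
move=> Fu.
have FTu : F^T \in unitmx by rewrite unitmx_tr.
have Ju : @J1 R \in unitmx by rewrite unitmxE det_J1 unitr1.
have gu : F *m J1 *m F^T \in unitmx by rewrite !unitmx_mul Fu Ju.
have E : F *m J1 *m F^T *m ((invmx F)^T *m J1 *m invmx F) = 1%:M.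
  rewrite trmx_inv !mulmxA mulmxK//.
  by rewrite -[F *m J1 *m J1]mulmxA mul_J1_J1 mulmx1 mulmxV.
by rewrite -[RHS](mulKmx gu) E mulmx1.
Qed.

(** Since J_1 is its own inverse, the operation X s^-1 Y on vectors F A J_1 F^t becomes the matrix
    product A B; both the metric and [lc_tensor] are built from this operation. *)
Lemma frame_mul (F A B : 'M[R]_4) : F \in unitmx ->
  F *m A *m J1 *m F^T *m invmx (F *m J1 *m F^T) *m (F *m B *m J1 *m F^T)
  = F *m (A *m B) *m J1 *m F^T.
Proof.
move=> Fu; have FTu : F^T \in unitmx by rewrite unitmx_tr.
rewrite invmx_frame// trmx_inv !mulmxA mulmxK// mulmxKV//.
by rewrite -[F *m A *m J1 *m J1]mulmxA mul_J1_J1 mulmx1.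
Qed.

Lemma metric_frame (F A B : 'M[R]_4) : F \in unitmx ->
  metric (F *m J1 *m F^T) (F *m A *m J1 *m F^T) (F *m B *m J1 *m F^T)
  = \tr (A *m B).
Proof.
move=> Fu; have FTu : F^T \in unitmx by rewrite unitmx_tr.
rewrite /metric -mulmxA -mulmxA mxtrace_mulC.
rewrite [X in \tr (X *m _)]mulmxA frame_mul// invmx_frame//
  trmx_inv !mulmxA mulmxK//.
rewrite -[F *m A *m B *m J1 *m J1]mulmxA mul_J1_J1 mulmx1.
by rewrite mxtrace_mulC !mulmxA mulVmx// mul1mx.
Qed.

End Matrices.

(** * The first-order Gauss map *)

Section Components.
Context (R : realType) (D : set (R * R)) (oD : open D).

Lemma pd_coord m n (h : R * R -> 'M[R]_(m, n)) i j l z : differentiable h z ->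
  pd l h z i j = pd l (fun w => h w i j) z.
Proof. by move=> dh; rewrite !pdE derive_mx ?mxE//; exact: diff_derivable. Qed.

Lemma smooth_on_coord m n (h : R * R -> 'M[R]_(m, n)) i j :
  smooth_on D h -> smooth_on D (fun w => h w i j).
Proof.
move=> /smooth_uptoP sh; apply/smooth_uptoP => N.
have dc (u : R * R -> 'M[R]_(m, n)) z : differentiable u z ->
    differentiable (fun w => u w i j) z.
  move=> du; have dij : differentiable (fun M : 'M[R]_(m, n) => M i j) (u z).
    exact: differentiable_coord.
  exact: differentiable_comp du dij.
elim: N h {sh}(sh N) => [|N IH] h [dh sh].
  by split=> // z Dz; exact/dc/dh.
split=> [z Dz|l]; first exact/dc/dh.
apply: (eq_smooth_upto oD _ (IH _ (sh l))) => w Dw.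
by rewrite pd_coord//; exact: dh.
Qed.

Lemma is_derive_smooth (h : R * R -> R) z v : smooth_on D h -> D z ->
  is_derive z v h (v.1 * pd true h z + v.2 * pd false h z).
Proof.
move=> sh Dz; have dh := smooth_on_diff sh Dz.
split; first exact: diff_derivable.
have vE : v = v.1 *: ((1, 0) : R * R) + v.2 *: ((0, 1) : R * R).
  case: v => x y; rewrite [LHS](_ : _ = (x * 1 + y * 0, x * 0 + y * 1))//.
  by rewrite !mulr0 !mulr1 addr0 add0r.
by rewrite !pdE !(deriveE _ dh) /= {1}vE linearD !linearZ.
Qed.

End Components.

Lemma free4_coef0 (K : fieldType) (V : vectType K) (v0 v1 v2 v3 : V)
    (k0 k1 k2 k3 : K) :
  free [:: v0; v1; v2; v3] ->
  k0 *: v0 + k1 *: v1 + k2 *: v2 + k3 *: v3 = 0 ->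
  [/\ k0 = 0, k1 = 0, k2 = 0 & k3 = 0].
Proof.
move=> /(@freeP _ _ 4 [tuple v0; v1; v2; v3]) fr E.
have := fr (fun i => [:: k0; k1; k2; k3]`_i).
rewrite !big_ord_recl big_ord0 /= addr0 !addrA => /(_ E) k_0.
by split; [exact: (k_0 0)|exact: (k_0 1)|exact: (k_0 2)|exact: (k_0 3)].
Qed.

Section GaussMap.
Context (R : realType) (D : set (R * R)) (b c p q : R * R -> R)
  (f : R * R -> 'cV[R]_4).
Context (oD : open D) (hf : surface_lift D b c p q f)
  (hbc : forall z, D z -> b z * c z != 0)
  (hF : forall z, D z -> \det (wilczynski_frame b c f z) = 1).
Local Notation X := (pd true).
Local Notation Y := (pd false).
Local Notation fi i := (fun z => f z i 0).
Let a z := X c z / (2 * c z).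
Let e z := Y b z / (2 * b z).
Let P := coefP b p a e.
Let Q := coefQ c q a e.
Let k := coefk b c e.
Let l := coefl b c a.
Let F := wilczynski_frame b c f.
Let g := gauss_map1 b c f.

Let sb : smooth_on D b. Proof. by case: hf => -[]. Qed.
Let sc : smooth_on D c. Proof. by case: hf => -[]. Qed.
Let sp : smooth_on D p. Proof. by case: hf => -[]. Qed.
Let sq : smooth_on D q. Proof. by case: hf => -[]. Qed.
Let sf : smooth_on D f. Proof. by case: hf. Qed.
Let sfi i : smooth_on D (fi i). Proof. exact: smooth_on_coord. Qed.

Let b0 z : D z -> b z != 0.
Proof. by move=> /hbc; rewrite mulf_eq0 negb_or => /andP[]. Qed.
Let c0 z : D z -> c z != 0.
Proof. by move=> /hbc; rewrite mulf_eq0 negb_or => /andP[]. Qed.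

Let sa : smooth_on D a.
Proof.
apply: (smooth_onM oD); first exact: smooth_on_pd.
apply: (smooth_onV oD); first by move=> z Dz; rewrite mulf_neq0// c0.
by apply: (smooth_onM oD) => //; exact: smooth_on_cst.
Qed.

Let se : smooth_on D e.
Proof.
apply: (smooth_onM oD); first exact: smooth_on_pd.
apply: (smooth_onV oD); first by move=> z Dz; rewrite mulf_neq0// b0.
by apply: (smooth_onM oD) => //; exact: smooth_on_cst.
Qed.

Let c_x z : D z -> X c z = 2 * a z * c z.
Proof. by move=> Dz; rewrite /a; field; rewrite c0. Qed.
Let b_y z : D z -> Y b z = 2 * e z * b z.
Proof. by move=> Dz; rewrite /e; field; rewrite b0. Qed.

Let pd_fi i m z : D z -> pd m f z i 0 = pd m (fi i) z.
Proof. by move=> Dz; apply: pd_coord; exact: smooth_on_diff Dz. Qed.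

Let pd2_fi i m n z : D z -> pd n (pd m f) z i 0 = pd n (pd m (fi i)) z.
Proof.
move=> Dz; rewrite pd_coord; last exact: smooth_on_diff (smooth_on_pd m sf) Dz.
by apply: (eq_on_pd n oD Dz) => w Dw; exact: pd_fi.
Qed.

Let fxx i z : D z -> X (X (fi i)) z = b z * Y (fi i) z + p z * fi i z.
Proof.
move=> Dz; rewrite -pd2_fi// !pd_x; case: hf => _ _ _ + _ _ => ->//.
by rewrite -pd_fi// pd_y !mxE.
Qed.

Let fyy i z : D z -> Y (Y (fi i)) z = c z * X (fi i) z + q z * fi i z.
Proof.
move=> Dz; rewrite -pd2_fi// !pd_y; case: hf => _ _ _ _ + _ => ->//.
by rewrite -pd_fi// pd_x !mxE.
Qed.

(** The coefficients in [lift_integrability] are the same for all four components, so these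
    identities assemble into one linear relation between f, f_x, f_y and f_xy, the last with
    coefficient 0, and freeness applies. *)
Let integrability z : D z ->
  Y (Y b) z + 2 * Y p z = 2 * b z * X c z + c z * X b z /\
  2 * Y b z * c z + b z * Y c z = X (X c) z + 2 * X q z.
Proof.
move=> Dz.
have [k0 [k1 [k2 [E1 E2 K]]]] : exists k0 k1 k2 : R, [/\
    k1 = 2 * Y b z * c z + b z * Y c z - X (X c) z - 2 * X q z,
    k2 = Y (Y b) z + 2 * Y p z - 2 * b z * X c z - c z * X b z &
    forall i, k0 * f z i 0 + k1 * X (fi i) z + k2 * Y (fi i) z = 0].
  do 3 eexists; split; [reflexivity|reflexivity|] => i.
  exact: (lift_integrability oD sb sc sp sq (sfi i) (fxx i) (fyy i) Dz).
have {}K : k0 *: f z + k1 *: dx f z + k2 *: dy f z + 0 *: dy (dx f) z = 0.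
  rewrite scale0r addr0; apply/matrixP => i j.
  have := K i; rewrite -(pd_fi i true Dz) -(pd_fi i false Dz) pd_x pd_y ord1.
  by move: (f z) (dx f z) (dy f z) => u v w Ki; rewrite !mxE.
have [_ /eqP k1' /eqP k2' _] := free4_coef0 (sl_free hf Dz) K.
move: k1' k2'; rewrite E1 E2 => k1' k2'.
split; apply/eqP; first by rewrite -subr_eq0 opprD addrA.
by rewrite -subr_eq0 opprD addrA.
Qed.

Let p_y z Dz := (@integrability z Dz).1.
Let q_x z Dz := (@integrability z Dz).2.

Let invPE z : D z -> invP b c p z = P z.
Proof.
move=> Dz; rewrite /invP /P /coefP -!pd_x -!pd_y.
rewrite (cxx oD sc sa c_x Dz) (c_x Dz) (b_y Dz); field.
by rewrite c0.
Qed.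

Let invQE z : D z -> invQ b c q z = Q z.
Proof.
move=> Dz; rewrite /invQ /Q /coefQ -!pd_x -!pd_y.
rewrite (byy oD sb se b_y Dz) (c_x Dz) (b_y Dz); field.
by rewrite b0.
Qed.

Let W i (j : nat) : R * R -> R :=
  nth (fun=> 0) [:: fi i; frame1 a (fi i); frame2 e (fi i);
    frame3 b c a e (fi i)] j.

Let FE z i j : D z -> F z i j = W i j z.
Proof.
move=> Dz; rewrite /F /wilczynski_frame mxE -!pd_x -!pd_y.
case: j => [[|[|[|[|//]]]] ?]; rewrite /W /=; first by [].
- rewrite /frame1 -(pd_fi i true Dz).
  by move: (f z) (pd true f z) => u v; rewrite !mxE.
- rewrite /frame2 -(pd_fi i false Dz).
  by move: (f z) (pd false f z) => u v; rewrite !mxE.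
rewrite /frame3 -(pd2_fi i true false Dz) -(pd_fi i true Dz) -(pd_fi i false Dz).
move: (f z) (pd true f z) (pd false f z) (pd false (pd true f) z) => u v w t.
rewrite !mxE /a /e; field.
by rewrite b0// c0.
Qed.

Let smooth_W i (j : 'I_4) : smooth_on D (W i j).
Proof.
case: j => [[|[|[|[|//]]]] ?]; rewrite /W /=.
- exact: sfi.
- exact: smooth_frame1.
- exact: smooth_frame2.
- exact: smooth_frame3.
Qed.

(** All directions v are treated at once because [conformal] tests the pulled-back metric on every
    vector. *)
Let dF z v : D z -> is_derive z v F
  (F z *m (v.1 *: frame_Ux (a z) (b z) (P z) (Q z) (k z)
         + v.2 *: frame_Uy (e z) (c z) (P z) (Q z) (l z))).
Proof.
move=> Dz; apply/is_derive_mxP => i j.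
have nE : \forall w \near z, W i j w = F w i j.
  by apply: (filterS (fun w Dw => esym (FE i j Dw))); exact: open_nbhs_nbhs.
apply: near_eq_is_derive nE _.
apply: is_derive_eq (is_derive_smooth v (smooth_W i j) Dz) _.
rewrite mxE; under eq_bigr do rewrite FE//.
rewrite !big_ord_recl big_ord0 /frame_Ux /frame_Uy mx4_scale mx4_scale mx4_add.
rewrite !mxE /W; case: j => [[|[|[|[|//]]]] ?] /=.
- by rewrite (frame0_x a (fi i) z) (frame0_y e (fi i) z); ring.
- rewrite (frame1_x oD e sa (sfi i) (fxx i) Dz).
  rewrite (frame1_y oD b c e sa (sfi i) Dz) -/(P z) -/(l z); ring.
- rewrite (frame2_x oD b c a se (sfi i) Dz).
  rewrite (frame2_y oD a se (sfi i) (fyy i) Dz) -/(Q z) -/(k z); ring.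
- rewrite (frame3_x oD sb sc sp sa se c_x b_y p_y (sfi i) (fxx i) (fyy i) Dz).
  rewrite (frame3_y oD sb sc sq sa se c_x b_y q_x (sfi i) (fxx i) (fyy i) Dz).
  rewrite -/(P z) -/(Q z) -/(k z) -/(l z); ring.
Qed.

Let Fu z : D z -> F z \in unitmx.
Proof. by move=> Dz; rewrite unitmxE hF// unitr1. Qed.

Lemma gauss_map1_in_calQ : maps_into_calQ D g.
Proof. by move=> z Dz; apply: calQ_congr; [exact: calQ_J1|exact: hF]. Qed.

Let Gx z := gauss_Ux (b z) (P z) (Q z) (k z).
Let Gy z := gauss_Uy (c z) (P z) (Q z) (l z).

(** Used twice: with M = J_1 constant it gives the first derivatives of the Gauss map, and with M =
    B J_1 the mixed second derivative. *)
Lemma is_derive_frame_congr (N M M' : R * R -> 'M[R]_4) z v :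
  is_derive z v F (F z *m N z) -> is_derive z v M (M' z) ->
  is_derive z v (fun w => F w *m M w *m (F w)^T)
    (F z *m (N z *m M z + M' z + M z *m (N z)^T) *m (F z)^T).
Proof.
move=> Fd Md.
apply: is_derive_eq (is_derive_mulmx (is_derive_mulmx Fd Md)
  (is_derive_trmx Fd)) _.
by rewrite trmx_mul !mulmxDr !mulmxDl !mulmxA.
Qed.

Let dg z v : D z ->
  'D_v g z = F z *m (v.1 *: Gx z + v.2 *: Gy z) *m J1 *m (F z)^T.
Proof.
move=> Dz; have cd : is_derive z v (fun=> J1 : 'M[R]_4) 0 by exact: is_derive_cst.
pose N (_ : R * R) := v.1 *: frame_Ux (a z) (b z) (P z) (Q z) (k z)
         + v.2 *: frame_Uy (e z) (c z) (P z) (Q z) (l z).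
have [_ ->] := @is_derive_frame_congr N (fun=> J1) (fun=> 0) z v (dF v Dz) cd.
congr (_ *m _); rewrite -[in RHS]mulmxA; congr (_ *m _).
rewrite addr0 /N mulmxDl linearD /= mulmxDr !linearZ /= -!scalemxAl addrACA.
by rewrite -!scalerDr frame_Ux_sym frame_Uy_sym mulmxDl -!scalemxAl.
Qed.

Let metric_dg z v : D z -> metric (g z) ('D_v g z) ('D_v g z) =
  16 * P z * v.1 ^+ 2 + 16 * Q z * v.2 ^+ 2
  + 2 * \tr (Gx z *m Gy z) * (v.1 * v.2).
Proof.
move=> Dz; rewrite dg// metric_frame; last exact: Fu.
rewrite mulmxDl !mulmxDr -!(scalemxAl, scalemxAr) !(mxtraceD, mxtraceZ).
rewrite /Gx /Gy gauss_Ux_trace gauss_Uy_trace.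
by rewrite [\tr (gauss_Uy _ _ _ _ *m _)]mxtrace_mulC; ring.
Qed.

Lemma gauss_map1_conformalP : conformal D g <-> demoulin D b c p q.
Proof.
split=> [[lam H] z Dz|H].
  (* On the null directions the form dx dy vanishes, which isolates the terms 16 P and 16 Q. *)
  have Ex := H z (1, 0) Dz; have Ey := H z (0, 1) Dz.
  rewrite metric_dg// /= in Ex; rewrite metric_dg// /= in Ey.
  by rewrite invPE// invQE//; split; lra.
exists (fun z => 2 * \tr (Gx z *m Gy z)) => z v Dz.
have [] := H z Dz; rewrite invPE// invQE// => P0 Q0.
by rewrite metric_dg// P0 Q0; ring.
Qed.

(** [coefl_x_lift] holds for every component of f with the same scalar factor, and f z != 0 supplies
    a component that can be cancelled. *)
Lemma demoulin_coefl_x z : demoulin D b c p q -> D z ->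
  X l z = - (2 * a z * l z).
Proof.
move=> H Dz.
have P0 w : D w -> P w = 0 by move=> Dw; have [] := H w Dw; rewrite invPE.
have E i := coefl_x_lift oD sb sc sp sa se c_x b_y p_y (sfi i) (fxx i)
  (fyy i) P0 Dz.
have [i fi0] : exists i, f z i 0 != 0.
  apply/existsP; apply: contraNT (sl_neq0 hf Dz); rewrite negb_exists.
  move=> /forallP f0; apply/eqP/matrixP => i j; rewrite ord1 mxE.
  by apply/eqP; rewrite -[_ == _]negbK; exact: f0.
by have /eqP := E i; rewrite mulf_eq0 (negPf fi0) orbF addr_eq0 => /eqP.
Qed.

Lemma gauss_map1_harmonic : demoulin D b c p q -> lorentz_harmonic D g.
Proof.
move=> H; exists (@lc_tensor R); first exact: lc_levi_civita.
have P0 w : D w -> P w = 0 by move=> Dw; have [] := H w Dw; rewrite invPE.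
have Q0 w : D w -> Q w = 0 by move=> Dw; have [] := H w Dw; rewrite invQE.
move=> z Dz; rewrite /pullback_dx.
have gx : dx g z = F z *m Gx z *m J1 *m (F z)^T.
  by rewrite /dx dg//= scale1r scale0r addr0.
have gy w : D w -> dy g w = F w *m Gy w *m J1 *m (F w)^T.
  by move=> Dw; rewrite /dy dg//= scale1r scale0r add0r.
(* P and Q vanish on all of D, so they are set to 0 before differentiating; only c and l remain to
   be differentiated. *)
pose M w := gauss_Uy (c w) 0 0 (l w) *m J1.
pose M' w := mx4 [:: [:: 0; 2 * (- (2 * a w * l w)); 0; 0];
              [:: 0; 0; 2 * (2 * a w * c w); 0];
              [:: 0; 0; 0; 2 * (- (2 * a w * l w))]; [:: 0; 0; 0; 0]].
pose N w := frame_Ux (a w) (b w) 0 0 (k w).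
have gy' w : D w -> dy g w = F w *m M w *m (F w)^T.
  by move=> Dw; rewrite gy// /Gy P0// Q0// /M mulmxA.
have Fd : is_derive z (1, 0) F (F z *m N z).
  by apply: is_derive_eq (dF (1, 0) Dz) _;
    rewrite /= scale1r scale0r addr0 P0// Q0.
have sl : smooth_on D l by exact: smooth_coefl.
have ld : is_derive z (1, 0) (fun w => 2 * l w) (2 * (- (2 * a z * l z))).
  apply: is_derive_eq (is_derive_mul (is_derive_cst (2 : R) z (1, 0))
    (is_derive_smooth (1, 0) sl Dz)) _.
  by rewrite /= demoulin_coefl_x//; ring.
have cd : is_derive z (1, 0) (fun w => 2 * c w) (2 * (2 * a z * c z)).
  apply: is_derive_eq (is_derive_mul (is_derive_cst (2 : R) z (1, 0))
    (is_derive_smooth (1, 0) sc Dz)) _.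
  by rewrite /= c_x//; ring.
have Gd : is_derive z (1, 0) (fun w => gauss_Uy (c w) 0 0 (l w)) (M' z).
  apply/is_derive_mxP; case=> [[|[|[|[|//]]]] ?]; case=> [[|[|[|[|//]]]] ?];
  under eq_fun do rewrite mxE /= ?mulr0; rewrite mxE /=;
  first [exact: is_derive_cst | exact: ld | exact: cd].
have Jd : is_derive z (1, 0) (fun=> J1 : 'M[R]_4) 0 by exact: is_derive_cst.
have Md : is_derive z (1, 0) M (M' z *m J1).
  by apply: is_derive_eq (is_derive_mulmx Gd Jd) _; rewrite mulmx0 addr0.
have -> : dx (dy g) z = F z *m (N z *m M z + M' z *m J1 + M z *m (N z)^T)
  *m (F z)^T.
  rewrite /dx (eq_on_derive ((1, 0) : R * R) oD Dz gy').
  pose M'J w := M' w *m J1.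
  by have [_ ->] := @is_derive_frame_congr N M M'J z (1, 0) Fd Md.
apply/eqP; rewrite subr_eq0; apply/eqP.
rewrite gx gy// /lc_tensor !frame_mul; try exact: Fu.
rewrite -!mulmxDl -mulmxDr 2!scalemxAl scalemxAr.
congr (_ *m _); rewrite -[in RHS]mulmxA; congr (_ *m _).
rewrite /Gx /Gy P0// Q0// -(demoulin_tension (a z)).
rewrite !mulmxDl mulmxA; congr (_ + _ + _).
(* The transposed term is matched through J_1 U^t = (A - U) J_1, a rearrangement of
   [frame_Ux_sym]. *)
rewrite /M -!mulmxA; congr (_ *m _).
by rewrite mulmxBl -(frame_Ux_sym (a z)) [X in X - _]addrC addrK.
Qed.

End GaussMap.

Theorem corollary2p4 (R : realType) (D : set (R * R))
  (b c p q : R * R -> R) (f : R * R -> 'cV[R]_4)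
  (hD : simply_connected_domain D)
  (hf : surface_lift D b c p q f)
  (hbc : forall z, D z -> b z * c z != 0)
  (hF : forall z, D z -> \det (wilczynski_frame b c f z) = 1) :
  demoulin D b c p q <->
  [/\ maps_into_calQ D (gauss_map1 b c f),
      conformal D (gauss_map1 b c f) &
      lorentz_harmonic D (gauss_map1 b c f)].
Proof.
have [_ oD _ _] := hD.
split=> [H|[_ /(gauss_map1_conformalP oD hf hbc hF)]]; last by [].
split; first exact: gauss_map1_in_calQ.
  exact/(gauss_map1_conformalP oD hf hbc hF).
exact: (gauss_map1_harmonic oD hf hbc hF).
Qed.
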